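(* Let $P\subset\mathbb{R}^d$ be a convex polytope containing the origin in its interior, and suppose that $$[P]=\sum_{i=1}^n \alpha_i[\Delta_i]$$ for non-codegenerate simplices $\Delta_1,\dots,\Delta_n\subset\mathbb{R}^d$ and integers $\alpha_1,\dots,\alpha_n$. Then $$[P^\circ]=\sum_{i=1}^n(-1)^{\sigma(\Delta_i)}\alpha_i[\Delta_i^\circ].$$
   Context: Here $d\ge 1$. For a polytopal region $Q\subset\mathbb{R}^d$, $[Q]$ denotes the restriction of Lebesgue measure on $\mathbb{R}^d$ to $Q$, and equalities are equalities of signed measures. A simplex means a full-dimensional ($d$-dimensional) simplex in $\mathbb{R}^d$; it is non-codegenerate if none of the affine hyperplanes spanned by its facets passes through the origin. For a convex polytope $P$ with the origin in its interior, $P^\circ=\{w\in\mathbb{R}^d:\langle w,v\rangle\le 1 \text{ for all } v\in P\}$ is the polar body, with $\langle\cdot,\cdot\rangle$ the standard inner product. For non-zero $v\in\mathbb{R}^d$ let $H_v=\{w : \langle w,v\rangle=1\}$. If $\Delta$ is a non-codegenerate simplex with vertices $v_0,\dots,v_d$ (not necessarily containing the origin), its polar simplex $\Delta^\circ$ is the (compact) simplex bounded by the hyperplanes $H_{v_0},\dots,H_{v_d}$; equivalently, its vertices are the points $w_0,\dots,w_d$ with $\langle w_i,v_j\rangle=1$ for all $j\neq i$. $\sigma(\Delta)$ is the number of supporting hyperplanes of $\Delta$ (the affine hyperplanes spanned by its $d+1$ facets) that separate $\Delta$ from the origin. *)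

(* Defs.v *)
From HB Require Import structures.
From mathcomp Require Import all_boot all_order all_algebra.
From mathcomp Require Import all_classical all_reals all_analysis.
Set Implicit Arguments.
Unset Strict Implicit.
Unset Printing Implicit Defensive.
Import Order.TTheory GRing.Theory Num.Theory.
Import numFieldNormedType.Exports.
Local Open Scope classical_set_scope.
Local Open Scope ring_scope.

Fact rV_display : measure_display.
Proof. by []. Qed.

(* The sigma-algebra on R^n generated by the coordinates, i.e. the product of
   n copies of the Borel sigma-algebra of R. *)
Section rV_measurable.
Variables (R : realType) (n : nat).

Definition rV_coord (i : 'I_n) (x : 'rV[R]_n) : measurableTypeR R := x ord0 i.

Let rV_measurable0 : g_sigma_preimage rV_coord set0.
Proof. exact: sigma_algebra0. Qed.

Let rV_measurableC A : g_sigma_preimage rV_coord A ->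
  g_sigma_preimage rV_coord (~` A).
Proof. exact: sigma_algebraC. Qed.

Let rV_measurable_bigcup (F : (set 'rV[R]_n)^nat) :
  (forall i, g_sigma_preimage rV_coord (F i)) ->
  g_sigma_preimage rV_coord (\bigcup_i F i).
Proof. exact: sigma_algebra_bigcup. Qed.

HB.instance Definition _ := @isMeasurable.Build rV_display
  'rV[R]_n (g_sigma_preimage rV_coord)
  rV_measurable0 rV_measurableC rV_measurable_bigcup.

Lemma measurable_rV_coord i : measurable_fun setT (rV_coord i).
Proof.
move=> _ Y mY; rewrite setTI; apply: sub_sigma_algebra => /=.
rewrite -bigcup_seq/=; exists i => /=; first by rewrite mem_index_enum.
by exists Y => //; rewrite setTI.
Qed.

Lemma measurable_fun_rV d (T : measurableType d) (f : T -> 'rV[R]_n) :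
  (forall i, measurable_fun setT (rV_coord i \o f)) -> measurable_fun setT f.
Proof.
move=> mf _ Y mY; rewrite setTI.
pose S := image_set_system setT f measurable.
suff : S Y by rewrite /S /image_set_system/= setTI.
move: Y mY; apply: smallest_sub.
  exact: sigma_algebra_image (sigma_algebra_measurable _).
rewrite -bigcup_seq/=; apply: bigcup_sub => i _ A [B mB <-].
rewrite /S /image_set_system /= !setTI.
by have := mf i measurableT B mB; rewrite setTI.
Qed.

End rV_measurable.

Section lebesgue_rV.
Variable R : realType.

Definition rV_cons n (p : measurableTypeR R * 'rV[R]_n) : 'rV[R]_n.+1 :=
  row_mx (p.1%:M : 'M[R]_1) p.2.

Lemma rV_cons0 n p : @rV_cons n p ord0 ord0 = p.1.
Proof.
have -> : (ord0 : 'I_n.+1) = lshift n (ord0 : 'I_1) by exact/val_inj.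
by rewrite /rV_cons (row_mxEl (p.1%:M : 'M[R]_1)) mxE eqxx mulr1n.
Qed.

Lemma rV_consS n p i : @rV_cons n p ord0 (lift ord0 i) = p.2 ord0 i.
Proof.
have -> : lift ord0 i = rshift 1 i :> 'I_n.+1 by exact/val_inj.
by rewrite /rV_cons (row_mxEr (p.1%:M : 'M[R]_1)).
Qed.

Lemma measurable_rV_cons n : measurable_fun setT (@rV_cons n).
Proof.
apply: measurable_fun_rV => i; have [j ->|->] := unliftP ord0 i.
- rewrite (_ : _ \o _ = rV_coord j \o snd).
    by apply: measurableT_comp => //; exact: measurable_rV_coord.
  by apply/funext => p /=; rewrite /rV_coord rV_consS.
- rewrite (_ : _ \o _ = fst) //.
  by apply/funext => p /=; rewrite /rV_coord rV_cons0.
Qed.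

Section step.
Variables (n : nat) (mu : {sigma_finite_measure set 'rV[R]_n -> \bar R}).

Definition lebesgue_rV_step : set 'rV[R]_n.+1 -> \bar R :=
  pushforward (@lebesgue_measure R \x mu)%E (@rV_cons n).

Let mcons A : measurable A -> measurable (@rV_cons n @^-1` A).
Proof. by move=> mA; rewrite -[X in measurable X]setTI; exact: measurable_rV_cons. Qed.

Let lebesgue_rV_step0 : lebesgue_rV_step set0 = 0%E.
Proof. by rewrite /lebesgue_rV_step /pushforward preimage_set0 measure0. Qed.

Let lebesgue_rV_step_ge0 A : (0 <= lebesgue_rV_step A)%E.
Proof. by rewrite /lebesgue_rV_step /pushforward; exact: measure_ge0. Qed.

Let lebesgue_rV_step_sigma_additive : semi_sigma_additive lebesgue_rV_step.
Proof.
move=> F mF tF mUF; rewrite /lebesgue_rV_step /pushforward preimage_bigcup.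
apply: measure_semi_sigma_additive.
- by move=> k; exact: mcons.
- apply/trivIsetP => /= i j _ _ ij; rewrite -preimage_setI.
  by move/trivIsetP : tF => /(_ _ _ _ _ ij) ->//; rewrite preimage_set0.
- by rewrite -preimage_bigcup; exact: mcons.
Qed.

HB.instance Definition _ := isMeasure.Build _ _ _ lebesgue_rV_step
  lebesgue_rV_step0 lebesgue_rV_step_ge0 lebesgue_rV_step_sigma_additive.

Let lebesgue_rV_step_sigma_finite : sigma_finite setT lebesgue_rV_step.
Proof.
have [F FT mF] : sigma_finite setT (@lebesgue_measure R \x mu)%E.
  have /sigma_finiteP[F [TF ndF Foo]] := sigma_finiteT (@lebesgue_measure R).
  have /sigma_finiteP[F' [TF' ndF' Foo']] := sigma_finiteT mu.
  exists (fun k => F k `*` F' k).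
    rewrite -setXTT TF TF'; apply/seteqP; split => -[x y] /=.
      move=> [[k _ Fx] [l _ Fy]]; exists (maxn k l) => //; split.
        by move: x Fx; exact/subsetPset/ndF/leq_maxl.
      by move: y Fy; exact/subsetPset/ndF'/leq_maxr.
    by move=> [k _ [? ?]]; split; exists k.
  move=> k; have [? ?] := Foo k; have [? ?] := Foo' k.
  split; first exact: measurableX.
  by rewrite product_measure1E// lte_mul_pinfty// ge0_fin_numE.
pose G (x : 'rV[R]_n.+1) : measurableTypeR R * 'rV[R]_n :=
  (x ord0 ord0, \row_i x ord0 (lift ord0 i)).
have GK : cancel (@rV_cons n) G.
  move=> [a v]; rewrite /G rV_cons0; congr pair.
  by apply/rowP => i; rewrite mxE rV_consS.
have mG : measurable_fun setT G.
  apply/measurable_fun_pairP; split; first exact: measurable_rV_coord.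
  apply: measurable_fun_rV => i.
  rewrite (_ : _ \o _ = rV_coord (lift ord0 i)); first exact: measurable_rV_coord.
  by apply/funext => x /=; rewrite /rV_coord mxE.
exists (fun k => G @^-1` F k).
  by rewrite -preimage_bigcup -FT preimage_setT.
move=> k; have [mFk Fk] := mF k; split.
  by rewrite -[X in measurable X]setTI; exact: mG.
rewrite /lebesgue_rV_step /pushforward -comp_preimage.
by rewrite (_ : G \o _ = id) ?preimage_id//; exact/funext.
Qed.

HB.instance Definition _ := Measure_isSigmaFinite.Build _ _ _
  lebesgue_rV_step lebesgue_rV_step_sigma_finite.

End step.

(* n-fold product of the Lebesgue measure on R; see [lebesgue_rV_box]. *)
Fixpoint lebesgue_rV n : {sigma_finite_measure set 'rV[R]_n -> \bar R} :=
  match n with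
  | 0 => \d_(0 : 'rV[R]_0)
  | n'.+1 => lebesgue_rV_step (lebesgue_rV n')
  end.

Lemma lebesgue_rV_box n (A : 'I_n -> set (measurableTypeR R)) :
  (forall i, measurable (A i)) ->
  lebesgue_rV n [set x | forall i, A i (x ord0 i)] =
  (\prod_(i < n) lebesgue_measure (A i))%E.
Proof.
elim: n A => [|n IH] A mA.
  by rewrite big_ord0 /= diracE mem_set// => -[].
rewrite big_ord_recl -IH//= /lebesgue_rV_step /pushforward.
have mB : measurable [set x : 'rV[R]_n | forall i, A (lift ord0 i) (x ord0 i)].
  rewrite (_ : [set _ | _] =
      \bigcap_(i in [set: 'I_n]) (rV_coord i @^-1` A (lift ord0 i))).
    apply: fin_bigcap_measurable => // i _.
    by rewrite -[X in measurable X]setTI; exact: measurable_rV_coord.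
  by apply/seteqP; split => x /= h i; [move=> _; exact: h|exact: (h i I)].
rewrite -product_measure1E//.
congr ((_ \x _)%E _); apply/seteqP; split => -[a v] /=.
  move=> h; split => [|i]; first by have := h ord0; rewrite rV_cons0.
  by have := h (lift ord0 i); rewrite rV_consS.
by move=> [h0 h] i; case: (unliftP ord0 i) => [j|] ->; rewrite ?rV_consS ?rV_cons0.
Qed.

End lebesgue_rV.

(* Lebesgue measure restricted to Q; two such (signed) measures are equal when
   they agree on every measurable set. *)
Definition lebesgue_on (R : realType) (d : nat) (Q : set 'rV[R]_d) :
  set 'rV[R]_d -> \bar R := fun A => lebesgue_rV R d (Q `&` A).

Section geometry.
Variables (R : realType) (d : nat).
Implicit Types (P D H : set 'rV[R]_d) (u w x : 'rV[R]_d).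

Definition dotv u w : R := \sum_(i < d) u ord0 i * w ord0 i.

Definition conv_hull m (v : 'I_m -> 'rV[R]_d) : set 'rV[R]_d :=
  [set x | exists c : 'I_m -> R,
    [/\ forall j, 0 <= c j, \sum_j c j = 1 & x = \sum_j c j *: v j]].

Definition convex_polytope P : Prop :=
  exists m (v : 'I_m -> 'rV[R]_d), P = conv_hull v.

Definition polar_body P : set 'rV[R]_d :=
  [set w | forall x, P x -> dotv w x <= 1].

Definition affinely_independent m (v : 'I_m -> 'rV[R]_d) : Prop :=
  forall c : 'I_m -> R, \sum_j c j = 0 -> \sum_j c j *: v j = 0 ->
  forall j, c j = 0.

(* A (full-dimensional) simplex is given by its vertices v_0, ..., v_d, which
   must be affinely independent; the simplex itself is [conv_hull v]. *)
Implicit Types v : 'I_d.+1 -> 'rV[R]_d.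

(* The affine hyperplane spanned by the facet opposite to [v i]. *)
Definition facet_hyperplane v (i : 'I_d.+1) : set 'rV[R]_d :=
  [set x | exists c : 'I_d.+1 -> R,
    [/\ c i = 0, \sum_j c j = 1 & x = \sum_j c j *: v j]].

Definition noncodegenerate v : Prop := forall i, ~ facet_hyperplane v i 0.

(* D lies in one closed half-space bounded by the hyperplane H and the origin
   in the open complementary one. *)
Definition separates_from_origin H D : Prop :=
  exists u (c : R), [/\ u != 0, H = [set x | dotv u x = c],
    dotv u 0 < c & forall x, D x -> c <= dotv u x].

Definition sigma v : nat :=
  #|[pred i | `[< separates_from_origin (facet_hyperplane v i) (conv_hull v) >]]|.

(* The [i]-th vertex of the polar simplex: the common point of the hyperplanes
   H_(v j), j != i. It exists and is unique for a non-codegenerate simplex. *)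
Definition polar_vertex v (i : 'I_d.+1) : 'rV[R]_d :=
  xget 0 [set w | forall j, j != i -> dotv w (v j) = 1].

Definition polar_simplex v : set 'rV[R]_d := conv_hull (polar_vertex v).

Lemma polar_vertexP v i : affinely_independent v -> noncodegenerate v ->
  forall w, (forall j, j != i -> dotv w (v j) = 1) <-> w = polar_vertex v i.
Proof.
move=> aff /(_ i) ncd.
pose M : 'M[R]_d := \matrix_k v (lift i k).
have dotM w k : (w *m M^T) ord0 k = dotv w (v (lift i k)).
  by rewrite mxE; apply: eq_bigr => j _; rewrite !mxE.
have M_unit : M \in unitmx.
  rewrite -row_free_unit -kermx_eq0; apply/rowV0P => a /sub_kermxP aM.
  pose c j := if unlift i j is Some k then a ord0 k else 0.
  have ci : c i = 0 by rewrite /c unlift_none.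
  have cl k : c (lift i k) = a ord0 k by rewrite /c liftK.
  have cv : \sum_j c j *: v j = 0.
    rewrite (bigD1_ord i)//= ci scale0r add0r -[RHS]aM mulmx_sum_row.
    by apply: eq_bigr => k _; rewrite cl rowK.
  have [s0|s0] := eqVneq (\sum_j c j) 0.
    by apply/rowP => k; rewrite -cl mxE; exact: aff.
  case: ncd; exists (fun j => c j / \sum_j c j); split.
  - by rewrite ci mul0r.
  - by rewrite -mulr_suml divff.
  - under eq_bigr => j _ do rewrite mulrC -scalerA.
    by rewrite -scaler_sumr cv scaler0.
have solP w : (forall j, j != i -> dotv w (v j) = 1) <-> w = const_mx 1 *m invmx M^T.
  split=> [h|-> j].
    rewrite -[w](mulmxK (_ : M^T \in unitmx)) ?unitmx_tr//; congr (_ *m _).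
    by apply/rowP => k; rewrite dotM mxE h// eq_sym neq_lift.
  case: (unliftP i j) => [k ->|->]; last by rewrite eqxx.
  by rewrite -dotM mulmxKV ?unitmx_tr// mxE.
have pvP : forall j, j != i -> dotv (polar_vertex v i) (v j) = 1.
  by apply: (@xgetPex _ 0 [set w | forall j, j != i -> dotv w (v j) = 1]);
    exists (const_mx 1 *m invmx M^T); exact/solP.
by move=> w; split=> [/solP ->|-> //]; exact/esym/solP.
Qed.

End geometry.

(* Main.v *)
Require Import Defs.
From HB Require Import structures.
From mathcomp Require Import all_boot all_order all_algebra.
From mathcomp Require Import all_classical all_reals all_analysis.
From mathcomp Require Import measurable_realfun ring lra.
Set Implicit Arguments.
Unset Strict Implicit.
Unset Printing Implicit Defensive.
Import Order.TTheory GRing.Theory Num.Theory.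
Import numFieldNormedType.Exports.
Local Open Scope classical_set_scope.
Local Open Scope ring_scope.

(** Fix w outside all the hyperplanes H_(v_ij) and compare indicator functions
at w; these hyperplanes are Lebesgue-null, so the identity of measures follows
by integration ([lebesgue_on_sum]).

Lift everything to R^(1+d): a vertex v_ij becomes the vector (1, v_ij), the
simplex Delta_i becomes the simplicial cone C_i generated by these vectors, the
origin becomes e = (1, 0), and w becomes the linear form l(r, x) = r - <w, x>,
which vanishes on none of the generators. Let a_ij be the barycentric
coordinates of the origin in Delta_i. Then sigma(Delta_i) is the number of
negative a_ij ([sigmaE]), and w lies in Delta_i° if and only if
a_ij * l(1, v_ij) >= 0 for all j ([polar_simplexE]). The second condition says
that e lies in the flipped cone, obtained from C_i by replacing each generator
on which l is negative by its opposite. Consequently the right-hand side,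
evaluated at w, is the value at e of the flipped sum: the signed sum of the
indicators of the flipped cones, with one sign per reversed generator
([flipped_simplex]).

The flipped sum is compared with the plain sum of the alpha_i [C_i] along a
generic ray from e in a direction y with l(y) < 0. Far along the ray the
flipped sum is 0. When the ray crosses a hyperplane, the jump of either sum is
a sum of the same kind for the facets of the C_i lying in that hyperplane, and
flipping commutes with taking jumps ([cone_sum_ray]). By induction on the
dimension, two facts result.
- If the plain sum vanishes where l < 0, flipping does not change it
  ([flip_cone_sum]).
- If the plain sum is the indicator of a convex cone K containing both e and y,
  the flipped sum vanishes at e ([flip_convex_cone]).

By hypothesis the plain sum is, off the walls, the indicator of the cone K over
P ([cone_sum_cone_over]). If w is in P° then l >= 0 on K and the first fact
gives the value 1. Otherwise K contains some y with l(y) < 0 and the second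
fact gives 0. *)

(** * Products of sign changes along a half-line *)

Lemma forall_setU1 (T : finType) (J : {set T}) k (p : pred T) :
  [forall j in k |: J, p j] = p k && [forall j in J, p j].
Proof.
apply/forall_inP/andP => [h|[pk /forall_inP h] j].
  split; first by apply: h; rewrite setU11.
  by apply/forall_inP => j jJ; apply: h; rewrite in_setU1 jJ orbT.
by rewrite in_setU1 => /predU1P[->//|/h].
Qed.

(** The value at infinity minus the value at time s of a product of step
functions is the sum of its jumps. Here [tau j] is the time at which the j-th
factor jumps and [up j] tells that it jumps from 0 to 1, so that its value at a
time t other than [tau j] is [up j == (tau j < t)]. The induction adds one
factor k: once it is 1, it may be dropped, and the time [tau k] at which it
changes serves as a new starting time for the other factors. *)
Lemma ray_telescope (R : realDomainType) (T : finType) (J : {set T})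
    (tau : T -> R) (up : pred T) (s : R) :
  {in J &, injective tau} -> {in J, forall j, tau j != s} ->
  [forall j in J, up j]%:R - [forall j in J, up j == (tau j < s)]%:R =
  \sum_(j in J | s < tau j)
     (if up j then 1 else -1) *
     [forall k in J :\ j, up k == (tau k < tau j)]%:R :> R.
Proof.
have [N] := ubnP #|J|; elim: N J s => // N IH J s cJ tau_inj tau_s.
have [->|[k kJ]] := set_0Vmem J.
  rewrite big_pred0 => [|j]; last by rewrite inE.
  have e0 (p : pred T) : [forall j in finset.set0, p j].
    by apply/forall_inP => j; rewrite inE.
  by rewrite !e0 subrr.
move: cJ tau_inj tau_s; rewrite -(finset.setD1K kJ).
set K := J :\ k => cJ tau_inj tau_s.
have kK : k \notin K by rewrite !inE eqxx.
have njk j : j \in K -> j != k by apply: contraTneq => ->.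
have KJ j : j \in K -> j \in k |: K by move=> jK; rewrite in_setU1 jK orbT.
have cK : (#|K| < N)%N by move: cJ; rewrite cardsU1 kK.
have IHs := IH K s cK (sub_in2 KJ tau_inj) (sub_in1 KJ tau_s).
have {IH} := IH K (tau k) cK (sub_in2 KJ tau_inj) _.
have /[swap] /[apply] IHk : {in K, forall j, tau j != tau k}.
  move=> j jK; apply: contra (njk _ jK) => /eqP jk; apply/eqP.
  by apply: tau_inj => //; [exact: KJ|rewrite setU11].
have tks : tau k != s by apply: tau_s; rewrite setU11.
rewrite !forall_setU1 big_mkcondr big_setU1//= -big_mkcondr/= setU1K//.
under eq_bigr => j /andP[jK _].
  have -> : (k |: K) :\ j = k |: (K :\ j).
    rewrite finset.setDUl; congr (_ :|: _); apply/finset.setDidPl.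
    by rewrite disjoints1 inE eq_sym njk.
  rewrite forall_setU1 -mulnb natrM mulrCA.
  over.
rewrite -!mulnb !natrM.
have [tks'|stk|/eqP] := ltgtP (tau k) s; last by rewrite (negbTE tks).
  rewrite add0r eqb_id -mulrBr IHs mulr_sumr; apply: eq_bigr => j /andP[_ sj].
  by rewrite (lt_trans tks' sj) eqb_id.
rewrite eqbF_neg; case: (up k); rewrite /= !(mul1r,mul0r,subr0,sub0r).
- move/eqP: IHk; rewrite subr_eq => /eqP ->; rewrite addrC; congr (_ + _).
  rewrite [LHS]big_mkcondr [RHS]big_mkcondr; apply: eq_bigr => j jK/=.
  have [kj|kj] := ltP (tau k) (tau j); first by rewrite (lt_trans stk kj) mul1r.
  by rewrite mul0r if_same.
- rewrite mulN1r; apply/eqP; rewrite eq_sym addrC subr_eq; apply/eqP.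
  rewrite [X in _ = X](_ : _ =
    ([forall j in K, up j]%:R - [forall j in K, up j == (tau j < s)]%:R) -
    ([forall j in K, up j]%:R - [forall j in K, up j == (tau j < tau k)]%:R));
    last by ring.
  rewrite IHs IHk.
  rewrite [X in X = _]big_mkcondr [X in _ = X - _]big_mkcondr.
  rewrite [X in _ = _ - X]big_mkcondr -sumrB.
  apply: eq_bigr => j jK/=.
  have [kj|kj] := ltP (tau k) (tau j); first by rewrite (lt_trans stk kj)/= mul0r subrr.
  by rewrite /= mul1r subr0.
Qed.

(** * Flipping simplicial cones *)

Lemma sum_by_value (R : realDomainType) (T : finType) (J : {set T})
    (tau : T -> R) (s : seq R) (F : T -> R) : uniq s ->
  {in s, forall t, 0 < t} ->
  (forall j, j \in J -> 0 < tau j -> tau j \in s) ->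
  \sum_(j in J | 0 < tau j) F j = \sum_(t <- s) \sum_(j in J | tau j == t) F j.
Proof.
move=> us s0 sJ; rewrite [RHS]big_seq.
rewrite (exchange_big_dep (fun j => (j \in J) && (0 < tau j)))/=.
  apply: eq_bigr => j /andP[jJ j0].
  rewrite big_mkcond (bigD1_seq (tau j)) ?sJ//= eqxx big1 ?addr0 => [|t jt].
    by rewrite jJ.
  by rewrite [tau j == t]eq_sym (negbTE jt) !andbF.
by move=> t j ts /andP[-> /eqP ->]; rewrite s0.
Qed.

(** For small positive e no nonzero [a k] changes sign when [e * c k] is
added. *)
Lemma small_shift (R : realFieldType) (K : finType) (a c : K -> R) :
  exists2 dlt, 0 < dlt & forall e, 0 < e < dlt ->
    forall k, a k != 0 -> 0 < a k * (a k + e * c k).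
Proof.
pose S := \sum_k `|c k / a k|.
have S0 : 0 <= S by apply: sumr_ge0.
exists (1 + S)^-1 => [|e /andP[e0 eS] k ak]; first by rewrite invr_gt0 ltr_pwDl.
have kS : `|c k / a k| <= S by rewrite /S (bigD1 k)//= lerDl sumr_ge0.
have eS1 : e * S < 1.
  apply: (@le_lt_trans _ _ (e * (1 + S))); first by rewrite ler_wpM2l ?(ltW e0)// lerDr.
  by rewrite -ltr_pdivlMr ?ltr_pwDl// mul1r.
have h : `|e * (c k / a k)| < 1.
  by rewrite normrM (gtr0_norm e0) (le_lt_trans _ eS1)// ler_pM2l.
rewrite (_ : _ * _ = a k ^+ 2 * (1 + e * (c k / a k))); last by field.
rewrite pmulr_rgt0 ?lt_def ?sqrf_eq0 ?ak ?sqr_ge0//.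
by move: h; rewrite ltr_norml => /andP[h _]; lra.
Qed.

Lemma exists_below (R : realFieldType) (d1 d2 : R) : 0 < d1 -> 0 < d2 ->
  exists e, [/\ 0 < e, e < d1 & e < d2].
Proof.
move=> d10 d20; exists (Num.min d1 d2 / 2).
have h : 0 < Num.min d1 d2 by rewrite lt_min d10.
have [h1 h2] : Num.min d1 d2 <= d1 /\ Num.min d1 d2 <= d2 by rewrite !ge_min !lexx orbT.
by split; lra.
Qed.

Section Flip.
Variables (R : realFieldType) (V : lmodType R) (n m : nat).
Variables (b : 'I_n -> 'I_m -> V) (phi : 'I_n -> 'I_m -> V -> R) (l : V -> R).
Hypothesis phi_lin : forall i j, scalar (phi i j).
Hypothesis l_lin : scalar l.
Hypothesis phi_b : forall i j k, phi i j (b i k) = (j == k)%:R.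
Hypothesis l_phi : forall i x, l x = \sum_j l (b i j) * phi i j x.
Hypothesis l_b : forall i j, l (b i j) != 0.

(** For [eps] constantly 1 this is the sum of the [beta i] times the indicator
of the open cone generated by the [b i j] with j in [J i]. For [eps i j] equal to
[l (b i j)] it is the sum of the flipped cones, generated by the
[Num.sg (l (b i j)) *: b i j], with the sign that counts the reversed
generators. Restricting the generators to [J i] lets faces of the cones be
described with the same vectors and coordinates. *)
Definition cone_sum (eps : 'I_n -> 'I_m -> R) (beta : 'I_n -> R)
    (J : 'I_n -> {set 'I_m}) (x : V) : R :=
  \sum_i beta i * (\prod_(j in J i) Num.sg (eps i j) *
    [forall j in J i, 0 < eps i j * phi i j x]%:R).

Lemma phiDZ i j x t y : phi i j (x + t *: y) = phi i j x + t * phi i j y.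
Proof. by rewrite addrC phi_lin addrC. Qed.

Section Ray.
Variables (beta : 'I_n -> R) (J : 'I_n -> {set 'I_m}) (x y : V).

Definition crossing_time i j := - phi i j x / phi i j y.

(** A cone with [beta i = 0] takes no part in a [cone_sum]: passing to a wall
discards a cone without facet in it by making its coefficient vanish. *)
Definition crossing_times : seq R :=
  undup [seq crossing_time ij.1 ij.2 | ij <- enum {: 'I_n * 'I_m}
    & [&& beta ij.1 != 0, ij.2 \in J ij.1 & 0 < crossing_time ij.1 ij.2]].

(** [wall_coef t] and [wall_gens t] describe the facets of the cones that lie
in the hyperplane crossed at time t, weighted by the direction of the
crossing. *)
Definition wall_coef t i :=
  beta i * \sum_(j in J i | phi i j (x + t *: y) == 0) Num.sg (phi i j y).

Definition wall_gens t i := [set j in J i | phi i j (x + t *: y) != 0]%SET.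

Hypothesis x_neq0 : forall i j, beta i != 0 -> j \in J i -> phi i j x != 0.
Hypothesis y_neq0 : forall i j, beta i != 0 -> j \in J i -> phi i j y != 0.
Hypothesis xy_neq : forall i j k, beta i != 0 -> j \in J i -> k \in J i ->
  j != k -> phi i k x * phi i j y != phi i j x * phi i k y.

(** The jumps are given by the same coefficients and the same facets for every
[eps]: reversing the generator opposite to a facet multiplies the sign of the
cone by -1, and it also puts the cone on the other side of that facet. *)
Lemma cone_sum_ray eps : (forall i j, eps i j != 0) ->
  cone_sum eps beta J y - cone_sum eps beta J x =
  \sum_(t <- crossing_times)
    cone_sum eps (wall_coef t) (wall_gens t) (x + t *: y).
Proof.
move=> eps0; rewrite /cone_sum exchange_big/= -sumrB; apply: eq_bigr => i _.
have [b0|b0] := eqVneq (beta i) 0.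
  by rewrite b0 !mul0r subrr big1// => t _; rewrite /wall_coef b0 !mul0r.
pose tau := crossing_time i.
have phiE j t : j \in J i -> phi i j (x + t *: y) = phi i j y * (t - tau j).
  by move=> jJ; rewrite phiDZ /tau /crossing_time; field; exact: y_neq0.
have phi0 j t : j \in J i -> (phi i j (x + t *: y) == 0) = (tau j == t).
  by move=> jJ; rewrite phiE// mulf_eq0 (negbTE (y_neq0 _ _))//= subr_eq0 eq_sym.
have tau_inj : {in J i &, injective tau}.
  move=> j k jJ kJ; apply: contra_eq => /(xy_neq b0 jJ kJ); apply: contraNneq.
  rewrite /tau /crossing_time => /eqP; rewrite eqr_div ?y_neq0// => /eqP.
  rewrite !mulNr => /oppr_inj e.
  by rewrite e mulrC.
pose up j := 0 < eps i j * phi i j y.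
have posE j t : j \in J i -> tau j != t ->
    (0 < eps i j * phi i j (x + t *: y)) = (up j == (tau j < t)).
  move=> jJ jt; rewrite phiE// mulrA.
  have : eps i j * phi i j y != 0 by rewrite mulf_neq0 ?eps0 ?y_neq0.
  rewrite /up; case: (ltgtP 0 (eps i j * phi i j y)) => // e _.
    by rewrite pmulr_rgt0// subr_gt0.
  rewrite nmulr_rgt0// subr_lt0 [false == _]eq_sym eqbF_neg -leNgt le_eqVlt.
  by rewrite [t == _]eq_sym (negbTE jt).
have /= tele := @ray_telescope R _ (J i) tau up 0 tau_inj _.
rewrite -[X in _ - _ * (_ * (nat_of_bool X)%:R)](_ :
    [forall j in J i, up j == (tau j < 0)] = _); last first.
  apply: eq_forallb_in => j jJ; rewrite -posE// ?scale0r ?addr0//.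
  by rewrite /tau /crossing_time mulf_neq0 ?oppr_eq0 ?invr_eq0 ?x_neq0 ?y_neq0.
rewrite -!mulrBr tele; last first.
  move=> j jJ.
  by rewrite /tau /crossing_time mulf_neq0 ?oppr_eq0 ?invr_eq0 ?x_neq0 ?y_neq0.
rewrite (@sum_by_value _ _ _ _ crossing_times) ?undup_uniq//; last 2 first.
- move=> t; rewrite mem_undup => /mapP[[i' j]]; rewrite mem_filter.
  by move=> /andP[/and3P[]] _ _ + _ ->.
- move=> j jJ j0; rewrite mem_undup; apply/mapP; exists (i, j) => //.
  by rewrite mem_filter mem_enum /= b0 jJ j0.
rewrite !mulr_sumr; apply: eq_bigr => t _.
rewrite /wall_coef -mulrA; congr (_ * _).
rewrite mulr_suml mulr_sumr.
apply: eq_big => [j|j /andP[jJ /eqP jt]].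
  by case: (boolP (j \in J i)) => //= jJ; rewrite phi0.
have -> : wall_gens t i = J i :\ j.
  apply/setP => k; rewrite !inE andbC; case: (boolP (k \in J i)) => kJ;
    rewrite ?andbF//= !andbT.
  rewrite phi0// -jt; congr (~~ _); apply/eqP/eqP => [/tau_inj->//|->//].
rewrite (big_setD1 j)//= !mulrA; congr (_ * (nat_of_bool _)%:R).
  rewrite mulrAC; congr (_ * _).
  have -> : (if up j then 1 else -1) = Num.sg (eps i j * phi i j y).
    rewrite /up; case: ltgtP (mulf_neq0 (eps0 i j) (y_neq0 b0 jJ)) => // h _.
      by rewrite gtr0_sg.
    by rewrite ltr0_sg.
  by rewrite sgrM mulrA -expr2 sqr_sg eps0 mul1r.
apply: eq_forallb_in => k; rewrite !inE => /andP[kj kJ]; rewrite -jt posE//.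
by apply: contra kj => /eqP /tau_inj ->.
Qed.

End Ray.

(** The induction on dimension stays in the ambient space V: a wall is a
subspace given by a predicate, and a face keeps its generators and coordinate
forms. *)
Definition linear_subspace (W : V -> Prop) :=
  W 0 /\ forall a u v, W u -> W v -> W (a *: u + v).

Definition generic (W : V -> Prop) x :=
  W x /\ forall i j u, W u -> phi i j u != 0 -> phi i j x != 0.

(** The second condition makes the ray from x in direction y cross the zero
sets of two coordinate forms simultaneously only if these forms are
proportional on W. *)
Definition general_direction (W : V -> Prop) x y :=
  generic W y /\ forall p q u, W u ->
    phi q.1 q.2 x * phi p.1 p.2 u - phi p.1 p.2 x * phi q.1 q.2 u != 0 ->
    phi q.1 q.2 x * phi p.1 p.2 y - phi p.1 p.2 x * phi q.1 q.2 y != 0.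

(** If the [b i j] form a basis of V with coordinates [phi i j], this says that
those with j in [J i] form a basis of W. *)
Definition bases_of (W : V -> Prop) (beta : 'I_n -> R) (J : 'I_n -> {set 'I_m}) :=
  forall i, beta i != 0 -> (forall j, j \in J i -> W (b i j)) /\
    (forall j u, j \notin J i -> W u -> phi i j u = 0).

Lemma phi0 i j : phi i j 0 = 0.
Proof. by have := phi_lin i j (-1) 0 0; rewrite scaler0 addr0 mulN1r addNr. Qed.

Lemma phiZ i j t y : phi i j (t *: y) = t * phi i j y.
Proof. by rewrite -[t *: y]add0r phiDZ phi0 add0r. Qed.

Lemma phiN i j y : phi i j (- y) = - phi i j y.
Proof. by rewrite -scaleN1r phiZ mulN1r. Qed.

Lemma linear_subspaceDZ W t u v : linear_subspace W -> W u -> W v -> W (u + t *: v).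
Proof. by move=> [_ h] Wu Wv; rewrite addrC; exact: h. Qed.

(** A vector space over an infinite field is not a finite union of proper
subspaces, and a generic direction u leaves at once all those through y0. *)
Lemma generic_avoid W (K : finType) (D : K -> V -> R) y0 :
  linear_subspace W -> (forall k, scalar (D k)) -> W y0 ->
  exists2 u, W u & exists2 dlt, 0 < dlt & forall e, 0 < e < dlt ->
    forall k v, W v -> D k v != 0 -> D k (y0 + e *: u) != 0.
Proof.
move=> subW linD Wy0.
have DDZ k x t y : D k (x + t *: y) = D k x + t * D k y by rewrite addrC linD addrC.
have [u Wu Du] : exists2 u, W u &
    forall k v, k \in enum K -> W v -> D k v != 0 -> D k u != 0.
  elim: (enum K) => [|k s [u Wu IH]]; first by exists 0 => //; case: subW.
  have [[v [Wv Dv]]|kv] := pselect (exists v, W v /\ D k v != 0); last first.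
    exists u => // k' v; rewrite inE => /predU1P[-> Wv Dv|]; last exact: IH.
    by case: kv; exists v.
  have [ku|ku] := eqVneq (D k u) 0; last first.
    by exists u => // k' v'; rewrite inE => /predU1P[->//|]; exact: IH.
  have [dlt dlt0 sm] := small_shift (D ^~ u) (D ^~ v).
  have e0 : 0 < dlt / 2 < dlt by apply/andP; split; lra.
  exists (u + (dlt / 2) *: v); first exact: linear_subspaceDZ.
  move=> k' v'; rewrite DDZ inE => /predU1P[-> _ _|k's Wv' Dv'].
    by rewrite ku add0r mulf_neq0// lt0r_neq0//; case/andP: e0.
  have := sm _ e0 k' (IH _ _ k's Wv' Dv').
  by apply: contraTneq => ->; rewrite mulr0 ltxx.
exists u => //.
have [dlt dlt0 sm] := small_shift (D ^~ y0) (D ^~ u).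
exists dlt => // e e0 k v Wv Dv; rewrite DDZ.
have [D0|D0] := eqVneq (D k y0) 0.
  rewrite D0 add0r mulf_neq0 ?(Du _ v) ?mem_enum// lt0r_neq0//.
  by case/andP: e0.
have := sm _ e0 k D0.
by apply: contraTneq => ->; rewrite mulr0 ltxx.
Qed.

Lemma exists_general_direction W x y0 : linear_subspace W -> W y0 ->
  exists2 u, W u & exists2 dlt, 0 < dlt & forall e, 0 < e < dlt ->
    general_direction W x (y0 + e *: u).
Proof.
move=> subW Wy0.
pose I2 := ('I_n * 'I_m)%type.
pose D (k : I2 * option I2) (v : V) : R := let p := k.1 in
  if k.2 is Some q then phi q.1 q.2 x * phi p.1 p.2 v - phi p.1 p.2 x * phi q.1 q.2 v
  else phi p.1 p.2 v.
have linD k : scalar (D k).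
  case: k => p [q|] a u v; rewrite /D/= ?phi_lin//; ring.
have [u Wu [dlt dlt0 h]] := generic_avoid subW linD Wy0.
exists u => //; exists dlt => // e e0; split.
  split; first exact: linear_subspaceDZ.
  by move=> i j v Wv; exact: (h e e0 ((i, j), None) v Wv).
by move=> p q v Wv; exact: (h e e0 (p, Some q) v Wv).
Qed.

Section Wall.
Variables (W : V -> Prop) (beta : 'I_n -> R) (J : 'I_n -> {set 'I_m}).
Variables (x y : V) (t : R) (i0 : 'I_n) (j0 : 'I_m).
Hypotheses (subW : linear_subspace W) (basW : bases_of W beta J).
Hypotheses (gx : generic W x) (gxy : general_direction W x y).
Let z := x + t *: y.
Hypotheses (b00 : beta i0 != 0) (j00 : j0 \in J i0) (z00 : phi i0 j0 z = 0).

Definition wall u := W u /\ phi i0 j0 u = 0.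

Let gy : generic W y := gxy.1.

Lemma generic_neq0 v i j : generic W v -> beta i != 0 -> j \in J i ->
  phi i j v != 0.
Proof.
move=> [_ gv] bi jJ; apply: (gv i j (b i j)); first exact: (basW bi).1.
by rewrite phi_b eqxx oner_eq0.
Qed.

Let x00 : phi i0 j0 x != 0. Proof. exact: generic_neq0. Qed.

(** At the general point z of the ray only forms proportional to that of the
wall vanish. *)
Lemma wall_proportional i j u : W u -> phi i j z = 0 ->
  phi i j u * phi i0 j0 x = phi i j x * phi i0 j0 u.
Proof.
move=> Wu zij; apply/eqP; rewrite -subr_eq0 mulrC; apply/negP => /negP.
move/(gxy.2 (i, j) (i0, j0) u Wu)/eqP; apply => /=.
move: z00 zij; rewrite !phiDZ => /eqP; rewrite addr_eq0 => /eqP -> /eqP.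
rewrite addr_eq0 => /eqP ->; ring.
Qed.

Lemma wall_phi0 i j u : wall u -> phi i j z = 0 -> phi i j u = 0.
Proof.
move=> [Wu u0] zij; have := wall_proportional Wu zij.
by rewrite u0 mulr0 => /eqP; rewrite mulf_eq0 (negbTE x00) orbF => /eqP.
Qed.

Lemma wall_subspace : linear_subspace wall.
Proof.
split; first by split; [case: subW|exact: phi0].
move=> a u v [Wu u0] [Wv v0]; split; first exact: subW.2.
by rewrite phi_lin u0 v0 mulr0 addr0.
Qed.

Lemma wall_point : wall z.
Proof. by split => //; apply: linear_subspaceDZ => //; [exact: gx.1|exact: gy.1]. Qed.

Lemma wall_point_generic : generic wall z.
Proof.
split=> [|i j u Hu]; first exact: wall_point.
by apply: contra_neq => /wall_phi0; exact.
Qed.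

Lemma wall_phi_neq0 v i j : generic wall v -> (phi i j v == 0) = (phi i j z == 0).
Proof.
move=> [Hv gv]; apply/eqP/eqP; last exact: wall_phi0.
by move=> v0; apply/eqP/negPn/negP => /(gv i j z wall_point); rewrite v0 eqxx.
Qed.

(** A cone has at most one facet in a given hyperplane, since its coordinate
forms are independent. *)
Lemma wall_unique i j k : beta i != 0 -> j \in J i -> k \in J i ->
  phi i j z = 0 -> phi i k z = 0 -> j = k.
Proof.
move=> bi jJ kJ zj zk; apply/eqP/negPn/negP => jk.
have Wj := (basW bi).1 _ jJ.
have := wall_proportional Wj zk; rewrite phi_b eq_sym (negbTE jk) mul0r => /esym/eqP.
rewrite mulf_eq0 (negbTE (generic_neq0 gx bi kJ))/= => /eqP e.
have := wall_proportional Wj zj; rewrite phi_b eqxx mul1r e mulr0 => /eqP.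
by rewrite (negbTE x00).
Qed.

Lemma wall_coef_neq0 i : wall_coef beta J x y t i != 0 ->
  beta i != 0 /\ exists2 j, j \in J i & phi i j z = 0.
Proof.
rewrite /wall_coef mulf_eq0 negb_or => /andP[-> h]; split=> //.
have [//|no] := pselect (exists2 j, j \in J i & phi i j z = 0).
case/negP: h; rewrite big_pred0// => j; apply/negP => /andP[jJ /eqP zj].
by apply: no; exists j.
Qed.

Lemma wall_coefE i j : beta i != 0 -> j \in J i -> phi i j z = 0 ->
  wall_coef beta J x y t i = beta i * Num.sg (phi i j y).
Proof.
move=> bi jJ zj; rewrite /wall_coef (big_pred1 j)// => k /=.
apply/andP/eqP => [[kJ /eqP zk]|->]; last by rewrite jJ; split=> //; exact/eqP.
exact: wall_unique zk zj.
Qed.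

Lemma wall_bases : bases_of wall (wall_coef beta J x y t) (wall_gens J x y t).
Proof.
move=> i /wall_coef_neq0[bi [k kJ zk]]; split=> [j|j u].
  rewrite inE => /andP[jJ zj]; have Wj := (basW bi).1 _ jJ; split=> //.
  have := wall_proportional Wj zk; rewrite phi_b (_ : k == j = false) ?mul0r; last first.
    by apply: contraNF zj => /eqP <-; exact/eqP.
  by move=> /esym/eqP; rewrite mulf_eq0 (negbTE (generic_neq0 gx bi kJ)) => /eqP.
rewrite inE negb_and negbK => /orP[jJ [Wu _]|/eqP zj Hu].
  exact: (basW bi).2.
exact: wall_phi0 zj.
Qed.

Lemma wall_card i : wall_coef beta J x y t i != 0 ->
  (#|wall_gens J x y t i| < #|J i|)%N.
Proof.
move=> /wall_coef_neq0[bi [k kJ zk]]; apply: proper_card; apply/properP; split.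
  by apply/fintype.subsetP => j; rewrite inE => /andP[].
by exists k => //; rewrite inE -/z zk eqxx andbF.
Qed.

Notation Gam := (cone_sum (fun _ _ => 1)).

(** The limit of the plain sum at a point z' of the wall, approached from the
side of u: a coordinate which vanishes on the wall takes the sign that it has
at u. *)
Definition side_value u z' := \sum_i beta i *
  [forall j in J i, 0 < if phi i j z == 0 then phi i j u else phi i j z']%:R.

Lemma cone_sum1E beta' J' v :
  Gam beta' J' v = \sum_i beta' i * [forall j in J' i, 0 < phi i j v]%:R.
Proof.
apply: eq_bigr => i _; rewrite big1 ?mul1r => [|j _]; last exact: sgr1.
by congr (_ * (nat_of_bool _)%:R); apply: eq_forallb_in => j _; rewrite mul1r.
Qed.

Lemma side_valueP z' u : generic wall z' -> W u -> phi i0 j0 u != 0 ->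
  exists2 dlt, 0 < dlt & forall e, 0 < e < dlt ->
    generic W (z' + e *: u) /\ Gam beta J (z' + e *: u) = side_value u z'.
Proof.
move=> gz' Wu u0.
have [dlt dlt0 sm] := small_shift (fun p : 'I_n * 'I_m => phi p.1 p.2 z')
  (fun p => phi p.1 p.2 u).
have pos i j e : 0 < e < dlt -> phi i j z != 0 ->
    0 < phi i j z' * phi i j (z' + e *: u).
  by move=> he; rewrite -(wall_phi_neq0 _ _ gz') phiDZ; exact: (sm e he (i, j)).
have shift0 i j e : phi i j z = 0 -> phi i j (z' + e *: u) = e * phi i j u.
  by move=> zj; rewrite phiDZ (wall_phi0 gz'.1 zj) add0r.
have u_neq0 i j v : W v -> phi i j v != 0 -> phi i j z = 0 -> phi i j u != 0.
  move=> Wv vj zj; have := gx.2 i j v Wv vj => xj.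
  have := wall_proportional Wu zj.
  by apply: contra_eqN => /eqP ->; rewrite mul0r eq_sym mulf_neq0.
exists dlt => // e he; have e0 : 0 < e by case/andP: he.
split.
  split=> [|i j v Wv vj]; first by apply: linear_subspaceDZ => //; exact: gz'.1.1.
  have [zj|zj] := eqVneq (phi i j z) 0.
    by rewrite shift0// mulf_neq0//; [exact: lt0r_neq0|exact: (u_neq0 i j v)].
  by have := pos i j e he zj; apply: contraTneq => ->; rewrite mulr0 ltxx.
rewrite cone_sum1E; apply: eq_bigr => i _; congr (_ * (nat_of_bool _)%:R).
apply: eq_forallb_in => j _; case: eqVneq => [zj|zj].
  by rewrite shift0// pmulr_rgt0.
have h := pos i j e he zj; apply/idP/idP => h'.
  by rewrite -(pmulr_lgt0 _ h').
by rewrite -(pmulr_rgt0 _ h').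
Qed.

(** The sum over the facets in the wall is the jump of the plain sum across the
wall, which is how information on the plain sum passes to the induction
hypothesis. *)
Lemma wall_jump z' : generic wall z' ->
  Gam (wall_coef beta J x y t) (wall_gens J x y t) z' =
  side_value y z' - side_value (- y) z'.
Proof.
move=> gz'; rewrite cone_sum1E -sumrB; apply: eq_bigr => i _.
have [bi|bi] := eqVneq (beta i) 0.
  by rewrite /wall_coef bi !mul0r subrr.
have [[k kJ zk]|no] := pselect (exists2 j, j \in J i & phi i j z = 0); last first.
  have zJ j : j \in J i -> (phi i j z == 0) = false.
    by move=> jJ; apply/negP => /eqP zj; apply: no; exists j.
  rewrite {1}/wall_coef big_pred0 => [|j]; last first.
    by apply/negP => /andP[jJ]; rewrite zJ.
  rewrite mulr0 mul0r; apply/esym/eqP; rewrite subr_eq0; apply/eqP.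
  congr (_ * (nat_of_bool _)%:R); apply: eq_forallb_in => j jJ.
  by rewrite zJ.
rewrite (wall_coefE bi kJ zk) -mulrBr -mulrA; congr (_ * _).
have Jk : J i = k |: wall_gens J x y t i.
  apply/setP => j; rewrite !inE; case: eqVneq => [->//|jk] /=.
  case: (boolP (j \in J i)) => //= jJ; apply/esym/eqP => zj.
  by case/eqP: jk; exact: wall_unique zj zk.
have rest u : [forall j in wall_gens J x y t i,
      0 < if phi i j z == 0 then phi i j u else phi i j z'] =
    [forall j in wall_gens J x y t i, 0 < phi i j z'].
  by apply: eq_forallb_in => j; rewrite inE => /andP[_ /negbTE ->].
rewrite Jk !forall_setU1 !rest zk eqxx phiN oppr_gt0 -!mulnb !natrM -mulrBl.
congr (_ * _); have := generic_neq0 gy bi kJ.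
by case: (ltgtP 0 (phi i k y)) => // h _;
  rewrite ?(gtr0_sg h) ?(ltr0_sg h) ?subr0 ?sub0r.
Qed.
End Wall.

Notation Gam := (cone_sum (fun _ _ => 1)).
Notation Phi := (cone_sum (fun i j => l (b i j))).

Lemma lDZ x t y : l (x + t *: y) = l x + t * l y.
Proof. by rewrite addrC l_lin addrC. Qed.

(** All the generators of the flipped cones lie on the side l > 0. *)
Lemma flipped_negative_side W beta J y : bases_of W beta J -> W y -> l y < 0 ->
  Phi beta J y = 0.
Proof.
move=> basW Wy ly; rewrite /cone_sum big1// => i _.
have [->|bi] := eqVneq (beta i) 0; first by rewrite mul0r.
rewrite (_ : [forall j in J i, _] = false) ?mulr0//.
apply/negP => /forall_inP h; move: ly; rewrite ltNge (l_phi i) => /negP; apply.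
apply: sumr_ge0 => j _; case: (boolP (j \in J i)) => [/h/ltW//|jJ].
by rewrite ((basW _ bi).2 j y jJ Wy) mulr0.
Qed.

(** Along the ray the plain and the flipped sum have the same jumps, and the
plain sum ends at its value at y, the flipped sum at 0. *)
Lemma flip_along_ray W beta J x y : linear_subspace W -> bases_of W beta J ->
  generic W x -> general_direction W x y -> l y < 0 ->
  (forall t i j, 0 < t -> beta i != 0 -> j \in J i -> phi i j (x + t *: y) = 0 ->
    Phi (wall_coef beta J x y t) (wall_gens J x y t) (x + t *: y) =
    Gam (wall_coef beta J x y t) (wall_gens J x y t) (x + t *: y)) ->
  Phi beta J x = Gam beta J x - Gam beta J y.
Proof.
move=> subW basW gx gxy ly walls.
have x0 i j : beta i != 0 -> j \in J i -> phi i j x != 0.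
  exact: (generic_neq0 basW gx).
have y0 i j : beta i != 0 -> j \in J i -> phi i j y != 0.
  exact: (generic_neq0 basW gxy.1).
have xy i j k : beta i != 0 -> j \in J i -> k \in J i ->
    j != k -> phi i k x * phi i j y != phi i j x * phi i k y.
  move=> bi jJ kJ jk; rewrite -subr_eq0.
  apply: (gxy.2 (i, j) (i, k) (b i j)); first exact: (basW i bi).1.
  by rewrite /= !phi_b eqxx [k == j]eq_sym (negbTE jk) mulr0 subr0 mulr1 x0.
have ray := cone_sum_ray x0 y0 xy.
have := ray _ l_b; rewrite (flipped_negative_side basW gxy.1.1 ly) sub0r => /eqP.
rewrite eqr_oppLR => /eqP ->; rewrite -opprB ray => [|i j]; last exact: oner_neq0.
congr (- _); apply: eq_big_seq => t; rewrite mem_undup => /mapP[[i j]].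
rewrite mem_filter => /andP[/and3P[/= bi jJ t0] _] tE.
apply: (walls t i j) => //; first by rewrite tE.
by rewrite phiDZ tE /crossing_time divfK ?subrr// y0.
Qed.

Lemma cone_sum_no_gens beta J x : (forall i, beta i != 0 -> J i = finset.set0) ->
  Phi beta J x = Gam beta J x.
Proof.
move=> J0; apply: eq_bigr => i _.
have [->|/J0 ->] := eqVneq (beta i) 0; first by rewrite !mul0r.
rewrite !big_set0; congr (_ * (_ * (nat_of_bool _)%:R)).
by apply: eq_forallb_in => j; rewrite inE.
Qed.

(** Induction on the number k of generators, i.e. on the dimension of W. On the
side l < 0 of a wall the plain sum vanishes near the wall, so that its jump is
zero there and the induction hypothesis applies to the wall. *)
Lemma flip_cone_sum k W beta J : linear_subspace W -> bases_of W beta J ->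
  (forall i, beta i != 0 -> (#|J i| <= k)%N) ->
  (forall x, generic W x -> l x < 0 -> Gam beta J x = 0) ->
  forall x, generic W x -> Phi beta J x = Gam beta J x.
Proof.
elim: k W beta J => [|k IH] W beta J subW basW cJ neg0 x gx.
  apply: cone_sum_no_gens => i /cJ.
  by rewrite leqn0 cards_eq0 => /eqP.
have [[i bi /set0Pn[j jJ]]|no] :=
  pselect (exists2 i, beta i != 0 & J i != finset.set0); last first.
  apply: cone_sum_no_gens => i bi; apply/eqP/negPn/negP => Ji.
  by apply: no; exists i.
have Wb := (basW i bi).1 j jJ.
(* l is negative at y0: its value there is the opposite of a square *)
pose y0 := 0 + - l (b i j) *: b i j.
have ly0 : l y0 < 0.
  have l0 : l 0 = 0 by have := l_lin (-1) 0 0; rewrite scaler0 addr0 mulN1r addNr.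
  rewrite lDZ l0 add0r mulNr oppr_lt0 -expr2 lt_def sqr_ge0 sqrf_eq0.
  by rewrite l_b.
have Wy0 : W y0 by apply: linear_subspaceDZ => //; case: subW.
have [u Wu [d1 d10 gd]] := exists_general_direction x subW Wy0.
have [d2 d20 sm] := small_shift (fun=> l y0 : R) (fun _ : 'I_1 => l u).
have [e [e0 ed1 ed2]] := exists_below d10 d20.
pose y := y0 + e *: u.
have gxy : general_direction W x y by apply: gd; rewrite e0.
have ly : l y < 0.
  rewrite /y lDZ -(nmulr_rgt0 _ ly0); apply: sm ord0 _; first by rewrite e0.
  exact: ltr0_neq0.
rewrite (flip_along_ray subW basW gx gxy ly) ?(neg0 y) ?subr0//; first exact: gxy.1.
move=> t i' j' t0 bi' jJ' zE.
apply: (IH (wall W i' j')).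
- exact: wall_subspace.
- exact: wall_bases.
- move=> i1 bi1; rewrite -ltnS; apply: leq_trans (cJ _ (wall_coef_neq0 bi1).1).
  exact: wall_card bi1.
- move=> z' gz' lz'; rewrite (wall_jump basW gx gxy bi' jJ' zE gz').
  have side0 v : W v -> phi i' j' v != 0 -> side_value beta J x y t v z' = 0.
    move=> Wv v0.
    have [d3 d30 sv] := side_valueP subW basW gx gxy bi' jJ' zE gz' Wv v0.
    have [d4 d40 sm'] := small_shift (fun=> l z' : R) (fun _ : 'I_1 => l v).
    have [e' [e'0 ed3 ed4]] := exists_below d30 d40.
    have [gv <-] := sv e' (introT andP (conj e'0 ed3)).
    apply: neg0 => //; rewrite lDZ -(nmulr_rgt0 _ lz').
    by apply: sm' ord0 _; rewrite ?e'0// ltr0_neq0.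
  have yn : phi i' j' y != 0 by apply: (generic_neq0 basW) => //; exact: gxy.1.
  rewrite !side0 ?subrr ?phiN ?oppr_eq0//; last by case: gxy.1.
  rewrite -[- y]add0r -scaleN1r; apply: linear_subspaceDZ => //.
    by case: subW.
  by case: gxy.1.
- exact: (wall_point_generic subW basW gx gxy bi' jJ' zE).
Qed.

(** The indicator of K has no jump across a wall that the ray from x crosses.
Let z' be a point of the wall and e be small. If K contains z' - e y, it
contains z' + e y because y is in K. Conversely, if K contains z' + e y, it
contains z' + e u for u = y + (2 / t) x, and u lies on the same side of the
wall as - y, because x and y are on opposite sides. *)
Lemma flip_convex_cone W beta J (K : V -> Prop) x y :
  linear_subspace W -> bases_of W beta J ->
  (forall u v, K u -> K v -> K (u + v)) -> (forall a u, 0 < a -> K u -> K (a *: u)) ->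
  (forall v, generic W v -> Gam beta J v = `[<K v>]%:R) ->
  generic W x -> general_direction W x y -> l y < 0 -> K x -> K y ->
  Phi beta J x = 0.
Proof.
move=> subW basW KD KZ GamK gx gxy ly Kx Ky.
have gy := gxy.1.
rewrite (flip_along_ray subW basW gx gxy ly) ?GamK ?asboolT ?subrr//.
move=> t i j t0 bi jJ zE.
apply: (@flip_cone_sum m (wall W i j)).
- exact: wall_subspace.
- exact: (wall_bases basW gx gxy bi jJ zE).
- by move=> i1 _; rewrite (leq_trans (max_card _))// card_ord.
- move=> z' gz' _; rewrite (wall_jump basW gx gxy bi jJ zE gz').
  have Wx := gx.1; have Wy := gy.1.
  have WNy : W (- y).
    by rewrite -[- y]add0r -scaleN1r; apply: linear_subspaceDZ => //; case: subW.
  have y0 : phi i j y != 0 by exact: (generic_neq0 basW).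
  pose u := y + (2 / t) *: x.
  have uE i' j' : phi i' j' (x + t *: y) = 0 -> phi i' j' u = phi i' j' (- y).
    rewrite /u phiN !phiDZ => /eqP; rewrite addr_eq0 => /eqP ->.
    by field; exact: lt0r_neq0.
  have Wu : W u by exact: linear_subspaceDZ.
  have Ny0 : phi i j (- y) != 0 by rewrite phiN oppr_eq0.
  have u0 : phi i j u != 0 by rewrite uE.
  have [d1 d10 s1] := side_valueP subW basW gx gxy bi jJ zE gz' Wy y0.
  have [d2 d20 s2] := side_valueP subW basW gx gxy bi jJ zE gz' Wu u0.
  have [d3 d30 s3] := side_valueP subW basW gx gxy bi jJ zE gz' WNy Ny0.
  have [e' [e'0 ed1 e'd2]] := exists_below d10 d20.
  have [e [e0 ee' ed3]] := exists_below e'0 d30.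
  have [g1 v1] := s1 e (introT andP (conj e0 (lt_trans ee' ed1))).
  have [g2 v2] := s2 e (introT andP (conj e0 (lt_trans ee' e'd2))).
  have [g3 v3] := s3 e (introT andP (conj e0 ed3)).
  have v23 : side_value beta J x y t u z' = side_value beta J x y t (- y) z'.
    apply: eq_bigr => i' _; congr (_ * (nat_of_bool _)%:R).
    by apply: eq_forallb_in => j' _; case: eqP => // /uE ->.
  move: v2 v3; rewrite -v1 v23 => <-; rewrite !GamK// => v3; apply/eqP.
  have [Ky'|nKy'] := pselect (K (z' + e *: y)).
    rewrite subr_eq0 !asboolT//.
    rewrite (_ : _ + _ = (z' + e *: y) + (e * (2 / t)) *: x).
      by apply: KD => //; apply: KZ => //; rewrite mulr_gt0// divr_gt0.
    by rewrite /u scalerDr addrA scalerA.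
  rewrite -v3 subr_eq0 (asboolF nKy') asboolF// => KNy; apply: nKy'.
  rewrite (_ : _ + _ = (z' + e *: (- y)) + (2 * e) *: y).
    by apply: KD => //; apply: KZ => //; rewrite mulr_gt0.
  by rewrite scalerN -addrA -scaleNr -scalerDl; congr (_ + _ *: _); ring.
- exact: (wall_point_generic subW basW gx gxy bi jJ zE).
Qed.

End Flip.

(** * Simplices and their polars in homogeneous coordinates *)

Lemma scalar_sum (R : pzRingType) (V : lmodType R) (f : V -> R) (I : finType)
    (c : I -> R) (x : I -> V) : scalar f ->
  f (\sum_i c i *: x i) = \sum_i c i * f (x i).
Proof.
move=> fl; elim/big_rec2: _ => [|i y1 y2 _ <-]; last exact: fl.
by have := fl (-1) 0 0; rewrite scaler0 addr0 mulN1r addNr.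
Qed.

Section Dotv.
Variables (R : realType) (d : nat).
Implicit Types u w x : 'rV[R]_d.

Lemma dotvC u w : dotv u w = dotv w u.
Proof. by apply: eq_bigr => i _; rewrite mulrC. Qed.

Lemma dotv_scalar w : scalar (dotv w).
Proof.
move=> a x y; rewrite /dotv mulr_sumr -big_split; apply: eq_bigr => i _.
by rewrite !mxE /=; ring.
Qed.

Lemma dotvDr w x y : dotv w (x + y) = dotv w x + dotv w y.
Proof. by rewrite -[x]scale1r dotv_scalar mul1r scale1r. Qed.

Lemma dotv0 w : dotv w 0 = 0.
Proof. by apply: big1 => i _; rewrite mxE mulr0. Qed.

Lemma dotvZr w a x : dotv w (a *: x) = a * dotv w x.
Proof. by rewrite -[_ *: _]addr0 dotv_scalar dotv0 addr0. Qed.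

Lemma dotv_sumr w (I : finType) (c : I -> R) (x : I -> 'rV_d) :
  dotv w (\sum_i c i *: x i) = \sum_i c i * dotv w (x i).
Proof. exact/scalar_sum/dotv_scalar. Qed.

Definition homog (r : R) x : 'rV[R]_(1 + d) := row_mx r%:M x.

Definition halfspace_form w (X : 'rV[R]_(1 + d)) : R :=
  X 0 (lshift d 0) - dotv w (rsubmx X).

Lemma homogP (X : 'rV[R]_(1 + d)) : X = homog (X 0 (lshift d 0)) (rsubmx X).
Proof.
rewrite -[LHS]hsubmxK; congr row_mx; apply/rowP => i; rewrite !mxE ord1.
by rewrite eqxx mulr1n; congr (X _ _); exact: val_inj.
Qed.

Lemma homogD r s x y : homog r x + homog s y = homog (r + s) (x + y).
Proof. by rewrite /homog add_row_mx raddfD. Qed.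

Lemma homogZ a r x : a *: homog r x = homog (a * r) (a *: x).
Proof. by rewrite /homog scale_row_mx scale_scalar_mx. Qed.

Lemma homog_sum (I : finType) (c : I -> R) (x : I -> 'rV_d) :
  \sum_i c i *: homog 1 (x i) = homog (\sum_i c i) (\sum_i c i *: x i).
Proof.
elim/big_rec3: _ => [|i X y z _ ->]; first by rewrite /homog raddf0 row_mx0.
by rewrite homogZ homogD mulr1.
Qed.

Lemma homog_inj r s x y : homog r x = homog s y -> r = s /\ x = y.
Proof.
move=> /eq_row_mx[/matrixP/(_ 0 0)]; rewrite !mxE eqxx !mulr1n => -> ->.
by [].
Qed.

Lemma halfspace_form_scalar w : scalar (halfspace_form w).
Proof.
move=> a X Y; rewrite /halfspace_form linearP/= dotv_scalar !mxE; ring.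
Qed.

Lemma halfspace_formE w r x : halfspace_form w (homog r x) = r - dotv w x.
Proof.
by rewrite /halfspace_form /homog row_mxEl row_mxKr mxE eqxx mulr1n.
Qed.
End Dotv.

Section Simplex.
Variables (R : realType) (d : nat) (v : 'I_d.+1 -> 'rV[R]_d).
Hypothesis aff : affinely_independent v.

Definition vertex_mx : 'M[R]_(1 + d) := \matrix_j homog 1 (v j).

Definition bary (j : 'I_d.+1) (X : 'rV[R]_(1 + d)) : R :=
  (X *m invmx vertex_mx) 0 j.

Lemma vertex_mx_unit : vertex_mx \in unitmx.
Proof.
rewrite -row_free_unit -kermx_eq0; apply/rowV0P => a /sub_kermxP.
rewrite mulmx_sum_row; under eq_bigr do rewrite rowK.
rewrite homog_sum => a0.
have [] : \sum_i a 0 i = 0 /\ \sum_i a 0 i *: v i = 0.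
  by apply: homog_inj; rewrite a0 /homog raddf0 row_mx0.
by move=> s0 sv0; apply/rowP => j; rewrite mxE; exact: aff s0 sv0 j.
Qed.

Lemma bary_scalar j : scalar (bary j).
Proof. by move=> a X Y; rewrite /bary mulmxDl -scalemxAl !mxE. Qed.

Lemma bary_vertex j k : bary j (homog 1 (v k)) = (j == k)%:R.
Proof.
rewrite /bary -[homog _ _](rowK (fun k => homog 1 (v k))) -row_mul.
by rewrite mulmxV ?vertex_mx_unit// !mxE eq_sym.
Qed.

Lemma bary_sum X : X = \sum_j bary j X *: homog 1 (v j).
Proof.
rewrite -[LHS](mulmxKV vertex_mx_unit) mulmx_sum_row.
by apply: eq_bigr => j _; rewrite rowK.
Qed.

Lemma bary_unique (c : 'I_d.+1 -> R) j :
  bary j (\sum_k c k *: homog 1 (v k)) = c j.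
Proof.
rewrite (scalar_sum _ _ (bary_scalar j)) (bigD1 j)//= bary_vertex eqxx mulr1.
by rewrite big1 ?addr0// => k kj; rewrite bary_vertex eq_sym (negbTE kj) mulr0.
Qed.

Lemma bary_affine x : \sum_j bary j (homog 1 x) = 1 /\
  x = \sum_j bary j (homog 1 x) *: v j.
Proof.
have := bary_sum (homog 1 x); rewrite homog_sum => /homog_inj[<- <-].
by [].
Qed.

Lemma conv_hullE : conv_hull v = [set x | forall j, 0 <= bary j (homog 1 x)].
Proof.
apply/seteqP; split => x /=.
  move=> [c [c0 c1 ->]] j.
  by have := bary_unique c j; rewrite homog_sum c1 => ->.
by move=> h; have [s1 sx] := bary_affine x; exists (fun j => bary j (homog 1 x)).
Qed.

Lemma facet_hyperplaneE j :
  facet_hyperplane v j = [set x | bary j (homog 1 x) = 0].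
Proof.
apply/seteqP; split => x /=.
  move=> [c [c0 c1 ->]].
  by have := bary_unique c j; rewrite homog_sum c1 => ->.
by move=> h; have [s1 sx] := bary_affine x; exists (fun j => bary j (homog 1 x)).
Qed.

Definition origin_bary j := bary j (homog 1 0).

Lemma baryE j x : bary j (homog 1 x) =
  origin_bary j + dotv (\row_k invmx vertex_mx (rshift 1 k) j) x.
Proof.
rewrite /origin_bary -[in LHS](addr0 1) -[in LHS](add0r x) -homogD.
rewrite -[X in bary j (X + _)]scale1r bary_scalar mul1r; congr (_ + _).
rewrite /bary /homog mxE big_split_ord /= big1 ?add0r => [|k _].
  by apply: eq_bigr => k _; rewrite row_mxEr !mxE mulrC.
by rewrite row_mxEl !mxE mul0rn mul0r.
Qed.

Hypothesis ncd : noncodegenerate v.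

Lemma origin_bary_neq0 j : origin_bary j != 0.
Proof. by apply/eqP => h; apply: (ncd (i := j)); rewrite facet_hyperplaneE. Qed.

(** The coordinate form of the j-th vertex is nonnegative on the simplex and
vanishes on the opposite facet, so it decides on which side the origin is. For
d = 0 no facet hyperplane has a nonzero normal vector. *)
Lemma separatesP j : (0 < d)%N ->
  separates_from_origin (facet_hyperplane v j) (conv_hull v) <->
  origin_bary j < 0.
Proof.
move=> d0; split=> [[u [c [u0 fE c0 cD]]]|aj].
  have [s1 s0] := bary_affine 0.
  rewrite dotv0 in c0.
  have facetv k : k != j -> dotv u (v k) = c.
    move=> kj; have : facet_hyperplane v j (v k).
      by rewrite facet_hyperplaneE /= bary_vertex eq_sym (negbTE kj).
    by rewrite fE.
  have vj : c < dotv u (v j).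
    rewrite lt_def cD ?andbT; last first.
      by rewrite conv_hullE /= => k; rewrite bary_vertex ler0n.
    apply/eqP => h; have : facet_hyperplane v j (v j) by rewrite fE.
    by rewrite facet_hyperplaneE /= bary_vertex eqxx => /eqP; rewrite oner_eq0.
  have : c + origin_bary j * (dotv u (v j) - c) = 0.
    rewrite -(dotv0 u) [in RHS]s0 dotv_sumr (bigD1 j)//=.
    under eq_bigr => k kj do rewrite facetv//.
    rewrite -mulr_suml; move: s1; rewrite (bigD1 j)//= => /eqP.
    rewrite addrC eq_sym -subr_eq => /eqP <-; rewrite /origin_bary; ring.
  move=> /eqP; rewrite addrC addr_eq0 => /eqP e.
  by rewrite -(pmulr_llt0 _ (_ : 0 < dotv u (v j) - c)) ?subr_gt0// e oppr_lt0.
pose u : 'rV[R]_d := \row_k invmx vertex_mx (rshift 1 k) j.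
have e x : bary j (homog 1 x) = origin_bary j + dotv u x := baryE j x.
exists u, (- origin_bary j); split.
- have [k kj] : exists k : 'I_d.+1, k != j.
    have : (0 < #|predC1 j|)%N by rewrite cardC1 card_ord.
    by move=> /card_gt0P[k]; exists k.
  apply/eqP => u0; have := e (v j); have := e (v k).
  rewrite !bary_vertex u0 eq_sym (negbTE kj) eqxx !(dotvC 0) !dotv0 => <- /eqP.
  by rewrite oner_eq0.
- rewrite facet_hyperplaneE; apply/seteqP; split=> x /=; rewrite e.
    by move/eqP; rewrite addrC addr_eq0 => /eqP.
  by move=> ->; rewrite subrr.
- by rewrite dotv0 oppr_gt0.
- by move=> x; rewrite conv_hullE => /(_ j); rewrite e addrC -lerBlDr sub0r.
Qed.

Lemma sigmaE : (0 < d)%N -> sigma v = #|[pred j | origin_bary j < 0]|.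
Proof.
move=> d0; apply: eq_card => j; rewrite !inE.
by apply/asboolP/idP => /(separatesP j d0).
Qed.

(** The j-th barycentric coordinate of w in the polar simplex is
[origin_bary j * (1 - dotv w (v j))]: the vertex w_j satisfies
1 - <w_j, v_j> = 1 / a_j, as one sees by applying w_j to 0 = sum_i a_i v_i. *)
Lemma polar_simplexE :
  polar_simplex v = [set w | forall j, 0 <= origin_bary j * (1 - dotv w (v j))].
Proof.
have pv i j : 1 - dotv (polar_vertex v i) (v j) = (i == j)%:R / origin_bary j.
  have a0 := origin_bary_neq0.
  have pvi : forall j, j != i -> dotv (polar_vertex v i) (v j) = 1.
    by apply/(polar_vertexP i aff ncd).
  case: eqVneq => [<-|ij]; last by rewrite pvi ?subrr ?mul0r// eq_sym.
  have [s1 s0] := bary_affine 0.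
  have := dotv0 (polar_vertex v i); rewrite {1}s0 dotv_sumr (bigD1 i)//=.
  under eq_bigr => k ki do rewrite pvi// mulr1.
  move: s1; rewrite (bigD1 i)//= => /eqP.
  rewrite addrC eq_sym -subr_eq => /eqP <- h.
  apply: (mulfI (a0 i)); rewrite mul1r divff//.
  by rewrite -[RHS]subr0 -h /origin_bary; ring.
have sum1 (c : 'I_d.+1 -> R) j : \sum_i c i = 1 ->
    1 - dotv (\sum_i c i *: polar_vertex v i) (v j) = c j / origin_bary j.
  move=> c1; rewrite dotvC dotv_sumr -[1 in LHS]c1 -sumrB.
  under eq_bigr => i _ do rewrite -[X in X - _]mulr1 -mulrBr dotvC pv.
  rewrite (bigD1 j)//= eqxx big1 ?addr0 ?mul1r// => i ij.
  by rewrite (negbTE ij) mul0r mulr0.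
apply/seteqP; split=> w /=.
  move=> [c [c0 c1 ->]] j; rewrite sum1// mulrC divfK ?c0//.
  exact: origin_bary_neq0.
move=> h; pose c j := origin_bary j * (1 - dotv w (v j)).
have c1 : \sum_j c j = 1.
  have [s1 s0] := bary_affine 0.
  rewrite /c; under eq_bigr => j _ do rewrite mulrBr mulr1.
  by rewrite sumrB -dotv_sumr -s0 dotv0 subr0.
exists c; split => //.
set w' := \sum_j _.
have ww' j : dotv w (v j) = dotv w' (v j).
  have := sum1 c j c1; rewrite /c -/w' mulrAC divff ?mul1r ?origin_bary_neq0//.
  by move=> /(congr1 (fun x => 1 - x)); rewrite !subKr => ->.
apply/rowP => k; have [_ kE] := bary_affine (delta_mx 0 k).
have dk u : dotv u (delta_mx 0 k) = u 0 k.
  rewrite /dotv (bigD1 k)//= mxE !eqxx mulr1 big1 ?addr0// => i ik.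
  by rewrite mxE (negbTE ik) andbF mulr0.
rewrite -[LHS]dk -[RHS]dk kE !dotv_sumr.
by apply: eq_bigr => j _; rewrite ww'.
Qed.

End Simplex.

(** * The cone over a convex body *)

Section Cube.
Variables (R : realType) (d : nat).
Implicit Types x y u w : 'rV[R]_d.

Definition cube x (r : R) : set 'rV[R]_d :=
  [set y | forall k, `|y ord0 k - x ord0 k| < r].

Lemma cubeE x r : cube x r =
  [set y | forall k, (`]x ord0 k - r, x ord0 k + r[%classic : set R) (y ord0 k)].
Proof.
by apply/seteqP; split=> y /= h k; have := h k;
  rewrite /= in_itv/= ltr_distl.
Qed.

Lemma measurable_box (A : 'I_d -> set (measurableTypeR R)) :
  (forall k, measurable (A k)) ->
  measurable [set y : 'rV[R]_d | forall k, A k (y ord0 k)].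
Proof.
move=> mA.
rewrite (_ : [set _ | _] = \bigcap_(i in [set: 'I_d]) (rV_coord i @^-1` A i)).
  apply: fin_bigcap_measurable => // i _.
  by rewrite -[X in measurable X]setTI; exact: measurable_rV_coord.
by apply/seteqP; split => y /= h i; [move=> _; exact: h|exact: (h i I)].
Qed.

Lemma measurable_cube x r : measurable (cube x r).
Proof.
rewrite cubeE.
apply: (@measurable_box (fun k => `]x ord0 k - r, x ord0 k + r[%classic)) => k.
exact: measurable_itv.
Qed.

Lemma lebesgue_cube x r : 0 < r ->
  lebesgue_rV R d (cube x r) = ((2 * r) ^+ d)%:E.
Proof.
move=> r0; rewrite cubeE.
rewrite (@lebesgue_rV_box _ _ (fun k => `]x ord0 k - r, x ord0 k + r[%classic));
  last by move=> k; exact: measurable_itv.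
rewrite (eq_bigr (fun=> (2 * r)%:E)) => [|k _].
  by rewrite prodEFin prodr_const card_ord.
rewrite lebesgue_measure_itv/= lte_fin ifT; last by lra.
by rewrite -EFinB; congr EFin; ring.
Qed.

Lemma dotv_cube w x y r : cube x r y ->
  `|dotv w (y - x)| <= r * \sum_k `|w ord0 k|.
Proof.
move=> h; rewrite mulr_sumr /dotv; apply: le_trans (ler_norm_sum _ _ _) _.
apply: ler_sum => k _; rewrite normrM mulrC ler_wpM2r//.
by rewrite !mxE; exact/ltW/h.
Qed.

End Cube.

Section Body.
Variables (R : realType) (d : nat) (P : set 'rV[R]_d).
Hypothesis P_convex : forall x y s, 0 <= s <= 1 -> P x -> P y ->
  P ((1 - s) *: x + s *: y).
Variable rho : R.
Implicit Types (a e r s : R) (x y p q w : 'rV[R]_d).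
Hypotheses (rho0 : 0 < rho) (P_cube : cube 0 rho `<=` P).

(** Membership in the closure of P. Since the decomposition only controls P up
to a null set, the closure is what can be recovered from it pointwise. *)
Definition adherent x := forall e, 0 < e -> exists2 p, P p & cube x e p.

Lemma adherentP x : P x -> adherent x.
Proof. by move=> Px e e0; exists x => // k; rewrite subrr normr0. Qed.

Lemma adherent_convex x y s : 0 <= s <= 1 -> adherent x -> adherent y ->
  adherent ((1 - s) *: x + s *: y).
Proof.
move=> s01 ax ay e e0; have [p Pp xp] := ax e e0; have [q Pq yq] := ay e e0.
exists ((1 - s) *: p + s *: q); first exact: P_convex.
move=> k; rewrite !mxE.
rewrite (_ : _ - _ = (1 - s) * (p ord0 k - x ord0 k) +
  s * (q ord0 k - y ord0 k)); last by ring.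
case/andP: s01 => s0 s1.
apply: le_lt_trans (ler_normD _ _) _; rewrite !normrM.
rewrite (ger0_norm s0) (@ger0_norm _ (1 - s)) ?subr_ge0//.
set b := `|p _ _ - _|; set a := `|q _ _ - _|.
have be : b < e := xp k; have ae : a < e := yq k.
have [->|sn] := eqVneq s 0; first by rewrite mul0r addr0 subr0 mul1r.
have : s * a < s * e by rewrite ltr_pM2l// lt_def sn.
have : (1 - s) * b <= (1 - s) * e by rewrite ler_wpM2l ?subr_ge0// ltW.
lra.
Qed.

Lemma adherent_polar w x : polar_body P w -> adherent x -> dotv w x <= 1.
Proof.
move=> Pw ax; apply/ler_addgt0Pr => e e0.
pose S : R := 1 + \sum_k `|w ord0 k|.
have S0 : 0 < S by rewrite ltr_pwDl// sumr_ge0.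
have [p Pp xp] := ax (e / S) (divr_gt0 e0 S0).
have := Pw p Pp; rewrite -{1}(subrK x p) dotvDr => h1.
have := dotv_cube w xp; rewrite ler_norml => /andP[h2 _].
have : e / S * \sum_k `|w ord0 k| <= e.
  by rewrite -mulrA ler_piMr ?(ltW e0)// mulrC ler_pdivrMr// mul1r lerDr.
lra.
Qed.

(** A contraction of P towards 0 maps a point of P near x to the centre of a
cube contained in P. *)
Lemma cube_in_body x r : 0 < r -> adherent x ->
  exists q s, [/\ 0 < s, cube q s `<=` P & cube q s `<=` cube x r].
Proof.
move=> r0 ax; have r20 : 0 < r / 2 by rewrite divr_gt0.
have [p Pp xp] := ax _ r20.
pose S : R := \sum_k `|p ord0 k|.
have S0 : 0 <= S by rewrite sumr_ge0.
have D0 : 0 < r / 2 + rho + S by rewrite ltr_wpDr// addr_gt0.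
pose s : R := (r / 2) / (r / 2 + rho + S).
have s0 : 0 < s by rewrite divr_gt0.
have s1 : s <= 1.
  rewrite /s ler_pdivrMr// mul1r. have := rho0; lra.
have sS : s * (rho + S) <= r / 2.
  rewrite /s mulrAC ler_pdivrMr// ler_wpM2l ?(ltW r20)//; have := rho0; lra.
exists ((1 - s) *: p), (s * rho); split; first exact: mulr_gt0.
  move=> y qy.
  rewrite (_ : y = (1 - s) *: p + s *: (s^-1 *: (y - (1 - s) *: p))).
    apply: P_convex => //; first by rewrite (ltW s0).
    apply: P_cube => k; rewrite !mxE subr0 normrM gtr0_norm ?invr_gt0//.
    by rewrite ltr_pdivrMl//; have := qy k; rewrite !mxE.
  by rewrite scalerA mulfV ?lt0r_neq0// scale1r addrC subrK.
move=> y qy k; have := qy k; have := xp k; rewrite !mxE => h1 h2.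
have pS : `|p ord0 k| <= S by rewrite /S (bigD1 k)//= lerDl sumr_ge0.
have h3 : `|s * p ord0 k| <= s * S.
  by rewrite normrM (gtr0_norm s0) ler_wpM2l// ltW.
move: h1 h2 h3; rewrite !ltr_norml !ler_norml => /andP[? ?] /andP[? ?] /andP[? ?].
apply/andP; split; lra.
Qed.

Definition cone_over (X : 'rV[R]_(1 + d)) :=
  exists r x, [/\ 0 < r, adherent x & X = homog r (r *: x)].

Lemma cone_overD X Y : cone_over X -> cone_over Y -> cone_over (X + Y).
Proof.
move=> [r [x [r0 ax ->]]] [s [y [s0 ay ->]]].
have rs0 : 0 < r + s by rewrite addr_gt0.
exists (r + s), ((1 - s / (r + s)) *: x + (s / (r + s)) *: y); split=> //.
  apply: adherent_convex => //; apply/andP; split.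
    by rewrite divr_ge0 ?(ltW s0) ?(ltW rs0).
  by rewrite ler_pdivrMr// mul1r; lra.
rewrite homogD; congr homog; rewrite scalerDr !scalerA.
by congr (_ *: _ + _ *: _); field; exact: lt0r_neq0.
Qed.

Lemma cone_overZ a X : 0 < a -> cone_over X -> cone_over (a *: X).
Proof.
move=> a0 [r [x [r0 ax ->]]]; exists (a * r), x; split=> //; first exact: mulr_gt0.
by rewrite homogZ scalerA.
Qed.

Lemma cone_over_form w X : polar_body P w -> cone_over X ->
  0 <= halfspace_form w X.
Proof.
move=> Pw [r [x [r0 ax ->]]]; rewrite halfspace_formE dotvZr.
have := adherent_polar Pw ax; rewrite -(ler_pM2l r0) mulr1; lra.
Qed.

Lemma cone_over_absorbs X : exists2 dlt, 0 < dlt & forall e, 0 < e < dlt ->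
  cone_over (homog 1 0 + e *: X).
Proof.
rewrite (homogP X); move: (X _ _) (rsubmx X) => a x.
pose S : R := \sum_k `|x ord0 k|.
have S0 : 0 <= S by rewrite sumr_ge0.
have D0 : 0 < `|a| * 2 + 1 + S * 2 / rho.
  have : 0 <= S * 2 / rho by rewrite divr_ge0 ?(ltW rho0)// mulr_ge0.
  have := normr_ge0 a; lra.
exists (`|a| * 2 + 1 + S * 2 / rho)^-1; first by rewrite invr_gt0.
move=> e /andP[e0]; rewrite -[X in _ < X]mul1r ltr_pdivlMr// => h.
have ea : e * `|a| < 1 / 2.
  have : 0 <= e * (1 + S * 2 / rho).
    by rewrite mulr_ge0 ?(ltW e0)// addr_ge0// divr_ge0 ?(ltW rho0)// mulr_ge0.
  by move: h; rewrite -addrA mulrDr; lra.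
have eS : e * S * 2 < rho.
  rewrite -[X in _ < X]mul1r -ltr_pdivrMr// -!mulrA; apply: le_lt_trans h.
  rewrite ler_wpM2l ?(ltW e0)// mulrA lerDr addr_ge0// mulr_ge0//.
have a2 : 1 / 2 < 1 + e * a.
  have : `|e * a| < 1 / 2 by rewrite normrM (gtr0_norm e0).
  by rewrite ltr_norml => /andP[]; lra.
have a0 : 0 < 1 + e * a by lra.
exists (1 + e * a), ((e / (1 + e * a)) *: x); split=> //; last first.
  rewrite homogZ homogD add0r; congr homog.
  by rewrite scalerA mulrCA mulfV ?lt0r_neq0// mulr1.
apply: adherentP; apply: P_cube => k; rewrite !mxE subr0 mulrAC normrM.
rewrite [X in _ * X]gtr0_norm ?invr_gt0// ltr_pdivrMr// normrM (gtr0_norm e0).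
have : `|x ord0 k| <= S by rewrite /S (bigD1 k)//= lerDl sumr_ge0.
rewrite -(ler_pM2l e0) => h1.
have : rho * (1 / 2) < rho * (1 + e * a) by rewrite ltr_pM2l.
lra.
Qed.

End Body.

(** * The identity of indicator functions *)

Section Decomposition.
Variables (R : realType) (d n : nat) (P : set 'rV[R]_d) (rho : R).
Hypothesis P_convex : forall x y s, 0 <= s <= 1 -> P x -> P y ->
  P ((1 - s) *: x + s *: y).
Hypotheses (rho0 : 0 < rho) (P_cube : cube 0 rho `<=` P).
Variables (v : 'I_n -> 'I_d.+1 -> 'rV[R]_d) (alpha : 'I_n -> R).
Hypothesis aff : forall i, affinely_independent (v i).
Hypothesis ncd : forall i, noncodegenerate (v i).
Hypothesis P_decomposition : forall A : set 'rV[R]_d, measurable A ->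
  lebesgue_on P A =
  (\sum_(i < n) (alpha i)%:E * lebesgue_on (conv_hull (v i)) A)%E.
Implicit Types (r s e : R) (x y q w : 'rV[R]_d) (X : 'rV[R]_(1 + d)).

Let phi i j := bary (v i) j.
Let all_gens (_ : 'I_n) := [set: 'I_d.+1]%SET.

Lemma sign_cube x : (forall i j, phi i j (homog 1 x) != 0) ->
  exists2 r, 0 < r & forall y, cube x r y -> forall i j,
    0 < phi i j (homog 1 x) * phi i j (homog 1 y).
Proof.
move=> x0.
pose u i j : 'rV[R]_d := \row_k invmx (vertex_mx (v i)) (rshift 1 k) j.
pose a (p : 'I_n * 'I_d.+1) := phi p.1 p.2 (homog 1 x).
have [dlt dlt0 sm] := small_shift a
  (fun p => - (Num.sg (a p) * \sum_k `|u p.1 p.2 ord0 k|)).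
have h2 : 0 < dlt / 2 < dlt by apply/andP; split; lra.
exists (dlt / 2) => [|y xy i j]; first by case/andP: h2.
pose N := \sum_k `|u i j ord0 k|; pose c := a (i, j).
have key : 0 < c * (c - Num.sg c * (dlt / 2 * N)).
  have -> : Num.sg c * (dlt / 2 * N) = - (dlt / 2 * - (Num.sg c * N)) by ring.
  by rewrite opprK; exact: (sm _ h2 (i, j) (x0 i j)).
have := dotv_cube (u i j) xy; rewrite -/N.
have -> : phi i j (homog 1 y) = c + dotv (u i j) (y - x).
  rewrite /c /a /phi/= !baryE -/(u i j) -addrA; congr (_ + _).
  by rewrite -dotvDr addrC subrK.
move: key (x0 i j); rewrite -[phi i j (homog 1 x)]/c; clearbody c.
move: (dotv _ _) (dlt / 2 * N) => D S key b0 /[!ler_norml] /andP[D1 D2].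
case: (ltgtP 0 c) b0 => // c0 _; move: key.
  rewrite (gtr0_sg c0) !(pmulr_rgt0 _ c0); lra.
rewrite (ltr0_sg c0) !(nmulr_rgt0 _ c0); lra.
Qed.

Notation plain_sum := (cone_sum phi (fun _ _ => 1) alpha all_gens).

(** On a cube where no coordinate form changes sign, each simplex is either
full or empty, so the measures of such cubes reveal the plain sum. *)
Lemma lebesgue_on_cube x r q s : 0 < s -> cube q s `<=` cube x r ->
  (forall y, cube x r y -> forall i j,
    0 < phi i j (homog 1 x) * phi i j (homog 1 y)) ->
  lebesgue_on P (cube q s) = (plain_sum (homog 1 x) * (2 * s) ^+ d)%:E.
Proof.
move=> s0 qx same; rewrite P_decomposition; last exact: measurable_cube.
rewrite cone_sum1E mulr_suml -sumEFin; apply: eq_bigr => i _.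
rewrite -mulrA [RHS]EFinM; congr (_ * _)%E; rewrite /lebesgue_on conv_hullE//.
case: (boolP [forall j in all_gens i, _]) => [/forall_inP pos|npos].
  rewrite mul1r -(lebesgue_cube q s0); congr (lebesgue_rV _ _ _).
  apply/setIidPr => y qy j; have := same y (qx _ qy) i j.
  by rewrite pmulr_rgt0 ?pos ?inE// => /ltW.
rewrite mul0r (_ : _ `&` _ = set0) ?measure0//; apply/seteqP; split=> // y [/= h qy].
case/negP: npos; apply/forall_inP => j _; have := same y (qx _ qy) i j.
rewrite lt_def mulf_eq0 negb_or => /andP[/andP[x0 y0]].
by rewrite pmulr_lge0 ?lt_def ?y0 ?h// x0.
Qed.

Lemma cone_sum_adherent x : (forall i j, phi i j (homog 1 x) != 0) ->
  plain_sum (homog 1 x) = `[< adherent P x >]%:R.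
Proof.
move=> x0; have [r r0 same] := sign_cube x0.
have [ax|nax] := pselect (adherent P x).
  rewrite asboolT//.
  have [q [s [s0 qP qx]]] := cube_in_body P_convex rho0 P_cube r0 ax.
  have := lebesgue_on_cube s0 qx same.
  rewrite /lebesgue_on (setIidr qP) lebesgue_cube// => -[] /eqP.
  rewrite -subr_eq0 -[X in X - _]mul1r -mulrBl mulf_eq0 expf_eq0.
  by rewrite mulf_eq0 pnatr_eq0/= (gt_eqF s0) andbF orbF subr_eq0 => /eqP.
rewrite asboolF//.
have [e e0 far] : exists2 e, 0 < e & forall p, P p -> ~ cube x e p.
  apply: contra_notP nax => nex e e0; apply: contra_notP nex => no.
  by exists e => // p Pp xp; apply: no; exists p.
have [s [s0 se sr]] := exists_below e0 r0.
have sx : cube x s `<=` cube x r by move=> y h k; apply: lt_trans sr.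
have := lebesgue_on_cube s0 sx same.
rewrite /lebesgue_on (_ : _ `&` _ = set0) ?measure0; last first.
  apply/seteqP; split=> // y [Py xy]; apply: (far y Py) => k.
  exact: lt_trans se.
move=> -[] /esym/eqP; rewrite mulf_eq0 expf_eq0 mulf_eq0 pnatr_eq0/=.
by rewrite (gt_eqF s0) andbF orbF => /eqP.
Qed.

Lemma cone_sum_cone_over X : (forall i j, phi i j X != 0) ->
  plain_sum X = `[< cone_over P X >]%:R.
Proof.
move=> X0; rewrite (homogP X) in X0 *.
move: (X _ _) (rsubmx X) X0 => r x X0.
have [r0|r0] := ltP 0 r; last first.
  rewrite asboolF; last first.
    by move=> [s [y [s0 _ /homog_inj[rs _]]]]; move: s0; rewrite -rs ltNge r0.
  rewrite cone_sum1E big1// => i _.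
  case: (boolP [forall j in all_gens i, _]) => [/forall_inP pos|_];
    last by rewrite mulr0.
  have [rE _] : r = \sum_j phi i j (homog r x) /\
      x = \sum_j phi i j (homog r x) *: v i j.
    by apply: homog_inj; rewrite -homog_sum -(bary_sum (@aff i)).
  have : 0 < r; last by rewrite ltNge r0.
  rewrite rE (bigD1 ord0)//= ltr_pwDl ?pos ?inE// sumr_ge0// => j _.
  by rewrite ltW// pos ?inE.
have xE : homog r x = r *: homog 1 (r^-1 *: x).
  by rewrite homogZ mulr1 scalerA mulfV ?scale1r// lt0r_neq0.
have phiE i j : phi i j (homog r x) = r * phi i j (homog 1 (r^-1 *: x)).
  by rewrite xE; exact: (phiZ (fun i j => bary_scalar (v i) j)).
have -> : plain_sum (homog r x) = plain_sum (homog 1 (r^-1 *: x)).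
  rewrite !cone_sum1E; apply: eq_bigr => i _; congr (_ * (nat_of_bool _)%:R).
  by apply: eq_forallb_in => j _; rewrite phiE pmulr_rgt0.
rewrite cone_sum_adherent => [|i j]; last first.
  by have := X0 i j; rewrite phiE mulf_eq0 negb_or => /andP[].
congr (nat_of_bool _)%:R; apply/asboolP/asboolP => [ax|].
  exists r, (r^-1 *: x); split=> //.
  by rewrite scalerA mulfV ?scale1r// lt0r_neq0.
move=> [s [y [s0 ay /homog_inj[rs ->]]]].
by rewrite -rs scalerA mulVf ?scale1r// lt0r_neq0.
Qed.

Section Point.
Variable w : 'rV[R]_d.
Hypothesis w_generic : forall i j, dotv w (v i j) != 1.
Let b i j := homog 1 (v i j).
Let l := halfspace_form w.

Let phi_lin i j : scalar (phi i j) := bary_scalar (v i) j.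
Let l_lin : scalar l := @halfspace_form_scalar R d w.

Let phi_b i j k : phi i j (b i k) = (j == k)%:R.
Proof. exact: bary_vertex. Qed.

Let l_phi i X : l X = \sum_j l (b i j) * phi i j X.
Proof.
rewrite {1}(bary_sum (@aff i) X) (scalar_sum _ _ l_lin).
by apply: eq_bigr => j _; rewrite mulrC.
Qed.

Let l_b i j : l (b i j) != 0.
Proof. by rewrite /l halfspace_formE subr_eq0 eq_sym. Qed.

Let all := fun _ : 'rV[R]_(1 + d) => True.
Let e := homog 1 (0 : 'rV[R]_d).

Let bas : bases_of b phi all alpha all_gens.
Proof. by move=> i _; split=> // j u; rewrite inE. Qed.

Let sub_all : linear_subspace all. Proof. by []. Qed.

Let generic_phi X : generic phi all X -> forall i j, phi i j X != 0.
Proof.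
by move=> [_ gX] i j; apply: (gX i j (b i j)) => //; rewrite phi_b eqxx oner_eq0.
Qed.

Let e_generic : generic phi all e.
Proof. by split=> // i j _ _ _; exact: origin_bary_neq0. Qed.

Let GammaK X : generic phi all X -> plain_sum X = `[< cone_over P X >]%:R.
Proof. by move=> /generic_phi; exact: cone_sum_cone_over. Qed.

Let e_cone : cone_over P e.
Proof.
exists 1, 0; split=> //; last by rewrite scaler0.
by apply: adherentP; apply: P_cube => k; rewrite mxE subr0 normr0.
Qed.

Lemma flipped_origin :
  cone_sum phi (fun i j => l (b i j)) alpha all_gens e =
  `[< polar_body P w >]%:R.
Proof.
have [Pw|nPw] := pselect (polar_body P w).
  rewrite asboolT//.
  rewrite (flip_cone_sum phi_lin l_lin phi_b l_phi l_b (k := d.+1) sub_all bas)//.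
  - by rewrite GammaK// asboolT.
  - by move=> i _; rewrite (leq_trans (max_card _))// card_ord.
  - move=> X gX lX; rewrite GammaK// asboolF// => KX.
    by have := cone_over_form Pw KX; rewrite leNgt lX.
rewrite asboolF//.
have [p Pp wp] : exists2 p, P p & 1 < dotv w p.
  apply: contra_notP nPw => nex x Px; rewrite leNgt; apply/negP => h.
  by apply: nex; exists x.
(* adding s e to the lift of p moves it into the interior of the cone over P
   and keeps l negative, which leaves room for a generic perturbation *)
pose s := (dotv w p - 1) / 2.
have s0 : 0 < s by rewrite divr_gt0// subr_gt0.
pose y0 := homog 1 p + s *: e.
have ly0 : l y0 < 0.
  rewrite /y0 addrC l_lin /l !halfspace_formE dotv0 subr0 mulr1 /s; lra.
have [u _ [d1 d10 gd]] := exists_general_direction phi_lin e (y0 := y0) sub_all I.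
have [d2 d20 sm] := small_shift (fun=> l y0 : R) (fun _ : 'I_1 => l u).
have [d3 d30 absorb] := cone_over_absorbs rho0 P_cube u.
have [t' [t'0 t'1 t'2]] := exists_below d10 d20.
have [t [t0 tt' t3]] := exists_below t'0 (mulr_gt0 s0 d30).
pose y := y0 + t *: u.
have ly : l y < 0.
  rewrite /y addrC l_lin addrC -(nmulr_rgt0 _ ly0); apply: sm ord0 _.
    by rewrite t0 (lt_trans tt').
  exact: ltr0_neq0.
have Ky : cone_over P y.
  have -> : y = homog 1 p + s *: (e + (t / s) *: u).
    rewrite /y /y0 scalerDr scalerA -addrA mulrCA mulfV ?mulr1//.
    exact: lt0r_neq0.
  apply: (cone_overD P_convex); last apply: cone_overZ => //.
    by exists 1, p; rewrite scale1r; split=> //; exact: adherentP.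
  by apply: absorb; rewrite divr_gt0//= ltr_pdivrMr// mulrC.
apply: (flip_convex_cone phi_lin l_lin phi_b l_phi l_b sub_all bas
  (K := cone_over P) (y := y)) => //.
- exact: (cone_overD P_convex).
- by move=> a X a0; exact: cone_overZ.
- by apply: gd; rewrite t0 (lt_trans tt').
Qed.

(** If the origin lies in the flipped cone, each factor [Num.sg (l (b i j))] is
the sign of the barycentric coordinate of the origin, and sigma counts the
negative ones. *)
Lemma flipped_simplex i : (0 < d)%N ->
  \prod_(j in all_gens i) Num.sg (l (b i j)) *
    [forall j in all_gens i, 0 < l (b i j) * phi i j e]%:R =
  (-1) ^+ sigma (v i) * `[< polar_simplex (v i) w >]%:R :> R.
Proof.
move=> d0; rewrite (sigmaE (@aff i) d0) (polar_simplexE (@aff i) (@ncd i)).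
have lE j : l (b i j) = 1 - dotv w (v i j) by rewrite /l halfspace_formE.
have -> : `[< [set w' | forall j, 0 <= origin_bary (v i) j *
      (1 - dotv w' (v i j))] w >] =
    [forall j in all_gens i, 0 < l (b i j) * phi i j e].
  apply/asboolP/forall_inP => /= [h j _|h j].
    rewrite lt_def mulf_neq0 ?l_b ?(origin_bary_neq0 (@aff i) (@ncd i))//=.
    by rewrite lE mulrC h.
  by rewrite mulrC -lE ltW// h ?inE.
case: (boolP [forall j in all_gens i, _]) => [/forall_inP h|_]; last by rewrite !mulr0.
congr (_ * _); rewrite -prodr_const [LHS]big_mkcond [RHS]big_mkcond.
apply: eq_bigr => j _; rewrite inE.
have := h j; rewrite inE => /(_ isT).
rewrite -[phi i j e]/(origin_bary (v i) j) inE.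
case: (ltP (origin_bary (v i) j) 0) => a0; first by rewrite nmulr_lgt0// => /ltr0_sg ->.
have {}a0 : 0 < origin_bary (v i) j.
  by rewrite lt_def a0 (origin_bary_neq0 (@aff i) (@ncd i)).
by rewrite pmulr_lgt0// => /gtr0_sg ->.
Qed.

End Point.

Theorem polar_indicator w : (0 < d)%N -> (forall i j, dotv w (v i j) != 1) ->
  `[< polar_body P w >]%:R =
  \sum_i (-1) ^+ sigma (v i) * alpha i * `[< polar_simplex (v i) w >]%:R :> R.
Proof.
move=> d0 w_generic; rewrite -(flipped_origin w_generic).
by apply: eq_bigr => i _; rewrite flipped_simplex// mulrCA mulrA.
Qed.

End Decomposition.

(** * Null hyperplanes and the identity of measures *)

Section Measure.
Variable R : realType.

Lemma measurable_dotv d (x : 'rV[R]_d) :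
  measurable_fun setT (fun w : 'rV[R]_d => dotv w x : measurableTypeR R).
Proof.
apply: measurable_sum => k; apply: measurable_funM; first exact: measurable_rV_coord.
exact: measurable_cst.
Qed.

Lemma measurable_dotv_preimage d (x : 'rV[R]_d) (B : set (measurableTypeR R)) :
  measurable B -> measurable [set w : 'rV[R]_d | B (dotv w x)].
Proof. by move=> mB; rewrite -[X in measurable X]setTI; exact: measurable_dotv. Qed.

(** By slicing along the first coordinate: the slices are again hyperplanes,
unless the normal vector x is a multiple of the first basis vector, in which
case the hyperplane is a box with a side reduced to one point. *)
Lemma lebesgue_hyperplane d (x : 'rV[R]_d) (c : R) : x != 0 ->
  lebesgue_rV R d [set w | dotv w x = c] = 0%E.
Proof.
elim: d x c => [|d IH] x c x0; first by rewrite [x]thinmx0 eqxx in x0.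
pose x' : 'rV[R]_d := \row_k x ord0 (lift ord0 k).
have dot_cons a (w : 'rV[R]_d) : dotv (rV_cons (a, w)) x = a * x ord0 ord0 + dotv w x'.
  rewrite /dotv big_ord_recl rV_cons0; congr (_ + _).
  by apply: eq_bigr => k _; rewrite rV_consS !mxE.
have [x'0|x'0] := eqVneq x' 0; last first.
  rewrite /= /lebesgue_rV_step /pushforward /product_measure1.
  apply: integral0_eq => a _ /=.
  rewrite -[RHS](IH x' (c - a * x ord0 ord0) x'0); congr (lebesgue_rV R d _).
  apply/seteqP; split=> w; rewrite /xsection/= inE/= dot_cons.
    by move=> <-; rewrite addrC addKr.
  by move=> ->; rewrite addrC subrK.
have x00 : x ord0 ord0 != 0.
  apply: contra x0 => /eqP x00; apply/eqP/rowP => k; rewrite mxE.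
  have [j ->|->//] := unliftP ord0 k.
  by have /rowP/(_ j) := x'0; rewrite !mxE.
pose A (k : 'I_d.+1) : set (measurableTypeR R) :=
  if k == ord0 then [set c / x ord0 ord0] else setT.
have -> : [set w : 'rV[R]_d.+1 | dotv w x = c] = [set w | forall k, A k (w ord0 k)].
  have dotE (w : 'rV[R]_d.+1) : dotv w x = w ord0 ord0 * x ord0 ord0.
    rewrite /dotv big_ord_recl big1 ?addr0// => k _.
    by have /rowP/(_ k) := x'0; rewrite !mxE => ->; rewrite mulr0.
  apply/seteqP; split=> w /=; rewrite dotE.
    by move=> wc k; rewrite /A; case: eqP => // ->; rewrite /= -wc mulfK.
  by move=> /(_ ord0); rewrite /A eqxx /= => ->; rewrite divfK.
rewrite lebesgue_rV_box => [|k]; last first.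
  by rewrite /A; case: eqP => _; [exact: measurable_set1|exact: measurableT].
by rewrite big_ord_recl {1}/A eqxx lebesgue_measure_set1 mul0e.
Qed.

Lemma conv_hull_bounded d m (u : 'I_m -> 'rV[R]_d) :
  exists2 r, 0 < r & conv_hull u `<=` cube 0 r.
Proof.
pose S := \sum_j \sum_k `|u j ord0 k|.
have S0 : 0 <= S by apply: sumr_ge0 => j _; exact: sumr_ge0.
exists (1 + S); first by rewrite ltr_pwDl.
move=> x [c [c0 c1 ->]] k; rewrite !mxE subr0 summxE.
apply: (@le_lt_trans _ _ S); last by lra.
apply: le_trans (ler_norm_sum _ _ _) _; apply: ler_sum => j _.
rewrite mxE normrM ger0_norm//; apply: (@le_trans _ _ `|u j ord0 k|).
  by rewrite ler_piMl// -c1 (bigD1 j)//= lerDl sumr_ge0.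
by rewrite (bigD1 k)//= lerDl sumr_ge0.
Qed.

Lemma lebesgue_on_sum d n (Q : set 'rV[R]_d) (S : 'I_n -> set 'rV[R]_d)
    (c : 'I_n -> R) (A : set 'rV[R]_d) :
  measurable A -> measurable Q -> (forall i, measurable (S i)) ->
  (forall i, (lebesgue_rV R d (S i) < +oo)%E) ->
  {ae lebesgue_rV R d, forall w, `[< Q w >]%:R = \sum_i c i * `[< S i w >]%:R :> R} ->
  lebesgue_on Q A = (\sum_i (c i)%:E * lebesgue_on (S i) A)%E.
Proof.
move=> mA mQ mS fS QS; rewrite /lebesgue_on -integral_indic//.
have intS i : (lebesgue_rV R d).-integrable A (fun w => (\1_(S i) w)%:E).
  apply/integrableP; split.
    by apply/measurable_EFinP; exact: measurable_indic.
  under eq_integral => w _ do rewrite gee0_abs ?lee_fin//.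
  rewrite integral_indic//; apply: le_lt_trans (fS i).
  by apply: le_measure; rewrite ?inE//; exact: measurableI.
under [RHS]eq_bigr => i _ do rewrite -integral_indic// -integralZl//.
rewrite -integral_sum//; last by move=> i; exact: integrableZl.
apply: ae_eq_integral => //.
- by apply/measurable_EFinP; exact: measurable_indic.
- by apply: emeasurable_sum => i; apply/measurable_int/integrableZl.
apply: filterS QS => w QSw _.
rewrite sumEFin; congr EFin; rewrite !indicE -[_ \in Q]/`[< _ >] QSw.
by apply: eq_bigr => i _; rewrite indicE.
Qed.

End Measure.

Theorem corollary2 (R : realType) (d : nat) (d_gt0 : (0 < d)%N)
  (P : set 'rV[R]_d) (P_polytope : convex_polytope P) (P_0 : interior P 0)
  (n : nat) (v : 'I_n -> 'I_d.+1 -> 'rV[R]_d) (alpha : 'I_n -> int)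
  (v_simplex : forall i, affinely_independent (v i))
  (v_noncodegenerate : forall i, noncodegenerate (v i))
  (P_decomposition : forall A : set 'rV[R]_d, measurable A ->
    lebesgue_on P A =
    (\sum_(i < n) ((alpha i)%:~R : R)%:E * lebesgue_on (conv_hull (v i)) A)%E) :
  forall A : set 'rV[R]_d, measurable A ->
    lebesgue_on (polar_body P) A =
    (\sum_(i < n) ((-1) ^+ sigma (v i) * (alpha i)%:~R : R)%:E *
       lebesgue_on (polar_simplex (v i)) A)%E.
Proof.
move=> A mA.
have [m [u PE]] := P_polytope.
have P_convex (x y : 'rV[R]_d) (s : R) : 0 <= s <= 1 -> P x -> P y ->
    P ((1 - s) *: x + s *: y).
  rewrite PE => /andP[s0 s1] [a [a0 a1 ->]] [b [b0 b1 ->]].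
  exists (fun j => (1 - s) * a j + s * b j); split.
  - by move=> j; rewrite addr_ge0// mulr_ge0// subr_ge0.
  - by rewrite big_split/= -!mulr_sumr a1 b1 !mulr1 subrK.
  - rewrite !scaler_sumr -big_split; apply: eq_bigr => j _.
    by rewrite /= !scalerA -scalerDl.
have [rho rho0 P_cube] : exists2 rho : R, 0 < rho & cube 0 rho `<=` P.
  have /nbhs_ballP[rho rho0 h] := P_0; exists rho => // y y0; apply: h.
  split=> // i k; rewrite ord1 /ball/= distrC; exact: y0.
have uP k : P (u k).
  rewrite PE; exists (fun j => (j == k)%:R); split=> [j||]; first exact: ler0n.
  - by rewrite (bigD1 k)//= eqxx big1 ?addr0// => j /negbTE ->.
  - rewrite (bigD1 k)//= eqxx scale1r big1 ?addr0// => j /negbTE ->.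
    by rewrite scale0r.
have mS i : measurable (polar_simplex (v i)).
  rewrite (polar_simplexE (@v_simplex i) (@v_noncodegenerate i)).
  rewrite (_ : [set w | _] = \bigcap_(j in [set: 'I_d.+1]) [set w |
      ((fun t : R => origin_bary (v i) j * (1 - t)) @^-1` `[0, +oo[) (dotv w (v i j))]).
    apply: fin_bigcap_measurable => // j _.
    apply: measurable_dotv_preimage; rewrite -[X in measurable X]setTI.
    suff mf : measurable_fun setT
        (fun t : measurableTypeR R => origin_bary (v i) j * (1 - t) : measurableTypeR R).
      by apply: mf => //; exact: measurable_itv.
    apply: measurable_funM => //; apply: measurable_funB => //.
  apply/seteqP; split=> w /= h j; first by move=> _; rewrite /= in_itv/= h.
  by have := h j I; rewrite /= in_itv/= andbT.
apply: lebesgue_on_sum => //.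
- rewrite (_ : polar_body P = \bigcap_(k in [set: 'I_m])
      [set w | `]-oo, 1]%classic (dotv w (u k))]).
    apply: fin_bigcap_measurable => // k _; apply: measurable_dotv_preimage.
    exact: measurable_itv.
  apply/seteqP; split=> w /= h; first by move=> k _; rewrite /= in_itv/= h.
  move=> x; rewrite PE => -[c [c0 c1 ->]]; rewrite dotv_sumr -c1.
  apply: ler_sum => j _; rewrite -[leRHS]mulr1 ler_wpM2l//.
  by have := h j I; rewrite /= in_itv.
- move=> i; have [r r0 h] := conv_hull_bounded (polar_vertex (v i)).
  apply: le_lt_trans (_ : lebesgue_rV R d (cube 0 r) < +oo)%E.
    by apply: le_measure; rewrite ?inE//; exact: measurable_cube.
  by rewrite lebesgue_cube// ltry.
have key := polar_indicator P_convex rho0 P_cube v_simplex v_noncodegenerate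
  P_decomposition.
suff : {ae lebesgue_rV R d, forall w,
    forall p : 'I_n * 'I_d.+1, dotv w (v p.1 p.2) != 1}.
  apply: filterS => w gw; apply: key => // i j; exact: (gw (i, j)).
apply: filter_forall => -[i j].
have [v0|v0] := eqVneq (v i j) 0.
  by apply: filterE => w /=; rewrite v0 dotv0 eq_sym oner_eq0.
exists [set w | dotv w (v i j) = 1]; split.
- exact: (measurable_dotv_preimage (v i j) (measurable_set1 1)).
- exact: lebesgue_hyperplane.
- by move=> w /= /negP; rewrite negbK => /eqP.
Qed.
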